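(* Let $\mathcal F$ be a good class and let $F$ be a holomorphic function on an open domain $D\subseteq\mathbb C$. If $F$ is in $\mathcal F$ on some non-empty open subset of $D$, then $F$ is in $\mathcal F$ on every compact subset of $D$.
   Context: $\mathbb C$ is identified with $\mathbb R^2$, with the maximum norm. A class $\mathcal F$ of functions $\mathbb N^n\to\mathbb N$ ($n$ varying) is good if it contains all constant functions, projections, the successor function and $x\dot- y=\max\{0,x-y\}$, and is closed under composition and bounded summation $f(\bar x,y)=\sum_{i=0}^y g(\bar x,i)$. Functions involving $\mathbb Q$ are coded by natural numbers ($z\in\mathbb Z$ by $(\max(z,0),-\min(0,z))$, $r\in\mathbb Q$ by $(z,n)$ with $r=z/n$, $n>0$, $\gcd(z,n)=1$) and are in $\mathcal F$ if the coded function is componentwise in $\mathcal F$. For open $O\subseteq\mathbb R^N$ and integer $e\ge1$ let $O_e=\{x\in O:|x|\le e,\ \mathrm{dist}(x,\mathbb R^N\setminus O)\ge1/e\}$. A function $F:O\to\mathbb R^M$ on an open set is in $\mathcal F$ if there are $\mathcal F$-functions $d:\mathbb N\to\mathbb N$ and $f:\mathbb Q^N\times\mathbb N\to\mathbb Q^M$ such that for all integers $e\ge1$, all $a\in\mathbb Q^N$ and all $x\in O_e$: $|x-a|<1/d(e)$ implies $|F(x)-f(a,e)|<1/e$. For a compact set $A\subseteq\mathbb R^N$, a function $F:A\to\mathbb R^M$ is in $\mathcal F$ if there are such $d,f$ with the same implication holding for all $x\in A$ (and all $e\ge1$, $a\in\mathbb Q^N$). *)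

(* Defs.v *)
From HB Require Import structures.
From mathcomp Require Import all_boot all_order all_algebra.
From mathcomp Require Import complex.
From mathcomp Require Import all_classical all_reals all_analysis.

Set Implicit Arguments.
Unset Strict Implicit.
Unset Printing Implicit Defensive.

Import Order.TTheory GRing.Theory Num.Theory numFieldNormedType.Exports.

Local Open Scope classical_set_scope.
Local Open Scope ring_scope.

Definition function_class := forall n : nat, set (n.-tuple nat -> nat).

Record good_class (C : function_class) : Prop := GoodClass {
  good_const : forall n k : nat, C n (fun=> k);
  good_proj : forall (n : nat) (i : 'I_n), C n (fun x => tnth x i);
  good_succ : C 1%N (fun x => (tnth x ord0).+1);
  good_monus : C 2%N (fun x => (tnth x ord0 - tnth x ord_max)%N);
  good_comp : forall (m n : nat) (f : m.-tuple nat -> nat)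
    (g : 'I_m -> n.-tuple nat -> nat),
    C m f -> (forall i, C n (g i)) -> C n (fun x => f [tuple g i x | i < m]);
  good_sum : forall (n : nat) (f g : n.+1.-tuple nat -> nat),
    C n.+1 g ->
    (forall (x : n.-tuple nat) (y : nat),
       f (rcons_tuple x y) = (\sum_(0 <= i < y.+1) g (rcons_tuple x i))%N) ->
    C n.+1 f }.

(* An integer z is coded by (max(z,0), -min(0,z)) and a rational by the code
   of its reduced numerator followed by its positive denominator. *)
Definition rat_code (r : rat) : 3.-tuple nat :=
  [tuple absz (Num.max (numq r) 0); absz (Num.min 0 (numq r)); absz (denq r)].

(* The codes of a_0, ..., a_(N-1), concatenated and followed by e. *)
Definition arg_code (N : nat) (a : 'rV[rat]_N) (e : nat) :
    (N * 3).+1.-tuple nat :=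
  rcons_tuple
    (allpairs_tuple (fun i k => tnth (rat_code (a 0 i)) k)
       (ord_tuple N) (ord_tuple 3)) e.

(* The coded function is only defined on codes: each of its components has to
   be the restriction of a member of the class. *)
Definition rat_fun_in (C : function_class) (N M : nat)
    (f : 'rV[rat]_N -> nat -> 'rV[rat]_M) : Prop :=
  forall (j : 'I_M) (k : 'I_3), exists2 g, C (N * 3).+1 g &
    forall a e, g (arg_code a e) = tnth (rat_code (f a e 0 j)) k.

Definition nat_fun_in (C : function_class) (d : nat -> nat) : Prop :=
  C 1%N (fun x => d (tnth x ord0)).

(* Extended-real valued, so that the distance to the empty set is +oo; the norm
   of 'rV[R]_N is the maximum norm. *)
Definition dist_to (R : realType) (N : nat) (A : set 'rV[R]_N) (x : 'rV[R]_N) :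
    \bar R :=
  ereal_inf [set (`|x - y|)%:E | y in A].

Definition exhaustion (R : realType) (N : nat) (O : set 'rV[R]_N) (e : nat) :
    set 'rV[R]_N :=
  [set x | [/\ O x, `|x| <= e%:R & ((e%:R^-1)%:E <= dist_to (~` O) x)%E]].

(* [approximable C X F] is the common shape of membership for open sets
   (X e := O_e) and for compact sets (X e := A).  The positivity of d is
   explicit because 1/0 = 0 would make the implication vacuous. *)
Definition approximable (C : function_class) (R : realType) (N M : nat)
    (X : nat -> set 'rV[R]_N) (F : 'rV[R]_N -> 'rV[R]_M) : Prop :=
  exists (d : nat -> nat) (f : 'rV[rat]_N -> nat -> 'rV[rat]_M),
    [/\ nat_fun_in C d, rat_fun_in C f,
        forall e, (1 <= e)%N -> (1 <= d e)%N &
        forall (e : nat) (a : 'rV[rat]_N) (x : 'rV[R]_N),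
          (1 <= e)%N -> X e x ->
          `|x - map_mx ratr a| < (d e)%:R^-1 ->
          `|F x - map_mx ratr (f a e)| < e%:R^-1].

Definition in_class_on_open (C : function_class) (R : realType) (N M : nat)
    (O : set 'rV[R]_N) (F : 'rV[R]_N -> 'rV[R]_M) : Prop :=
  approximable C (exhaustion O) F.

Definition in_class_on_compact (C : function_class) (R : realType) (N M : nat)
    (A : set 'rV[R]_N) (F : 'rV[R]_N -> 'rV[R]_M) : Prop :=
  approximable C (fun=> A) F.

Definition plane_of_complex (R : realType) (z : R[i]) : 'rV[R]_2 :=
  \row_(i < 2) (if i == 0 then complex.Re z else complex.Im z).

Definition plane_set (R : realType) (U : set R[i]^o) : set 'rV[R]_2 :=
  @plane_of_complex R @` U.

Definition plane_fun (R : realType) (F : R[i]^o -> R[i]^o) :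
    'rV[R]_2 -> 'rV[R]_2 :=
  fun v => plane_of_complex (F (v 0 0 +i* v 0 1)%C).

(* R[i]^o is a normed module over R[i] itself: derivability in direction 1 is
   convergence of (F (z + h) - F z) / h as h tends to 0 in R[i]. *)
Definition holomorphic_on (R : realType) (D : set R[i]^o)
    (F : R[i]^o -> R[i]^o) : Prop :=
  forall z, D z -> derivable F z 1.

(* Main.v *)
Require Import Defs.
From HB Require Import structures.
From mathcomp Require Import all_boot all_order all_algebra.
From mathcomp Require Import complex.
From mathcomp Require Import all_classical all_reals all_analysis.
From mathcomp Require Import zify ring lra.

Set Implicit Arguments.
Unset Strict Implicit.
Unset Printing Implicit Defensive.

Import Order.TTheory GRing.Theory Num.Theory numFieldNormedType.Exports.

Local Open Scope classical_set_scope.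
Local Open Scope ring_scope.

(** The good points, those with a neighbourhood on which [F] is in the class, form
    an open set; by connectedness it suffices to show that a limit point [p] in [D]
    of good points is good, and compactness then gives the theorem.  Let [T] be the
    shift by [d := v / (a n)], where [v] is rational and [p + v] is good.  Expanding
    [1 = (T + (1 - T)) ^ N] with [N = (a + 1) n] and dropping the terms with fewer
    than [a n] factors [T] expresses [F z], for [z] near [p], as an integral
    combination of values of [F] near [p + v].  The dropped terms are differences of
    order greater than [n], which Cauchy's formula bounds by [O(2 ^ - n)].  For
    precision [1 / e] one takes [n] of order [log e]; the coefficients and [2 ^ N]
    are then polynomial in [e], and the binomial coefficients can be computed inside
    the class by counting binary words.  Cauchy's formula on rectangles is obtained
    from Goursat's bisection argument. *)

(** * Functions in a good class *)

(** Three obstacles shape the construction. First, a good class may contain only functions of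
    polynomial growth, so all auxiliary integers must stay polynomial in the data. The order [n] of
    the differences can then only be logarithmic in [e], and the error has to decay geometrically in
    [n]. It does: Cauchy's estimate for a difference of order [j] contains [j! |d| ^ j], the
    binomial weight satisfies [C(N, j) j! <= N ^ j], and [N |d| = (1 + 1 / a) |v|] is a fixed small
    part of the radius of holomorphy. Second, the neighbourhood of [p + v] on which [F] is already
    approximated may be much smaller than [|v|]. The kept nodes [z + l d] have
    [a n <= l <= (a + 1) n], so they lie between [z + v] and [z + (1 + 1 / a) v]; their spread
    [|v| / a] is made small by the choice of [a], which is independent of [e]. Third, coded
    rationals are in lowest terms, and reducing a sum of fractions would call for gcds. All
    computation is therefore done with integers over a common denominator, and fractions are
    perturbed to visibly reduced ones only at the interface. *)

Definition front (n : nat) (y : n.+1.-tuple nat) : n.-tuple nat :=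
  [tuple tnth y (widen_ord (leqnSn n) i) | i < n].

Definition final (n : nat) (y : n.+1.-tuple nat) : nat := tnth y ord_max.

Lemma front_rcons (n : nat) (x : n.-tuple nat) (i : nat) :
  front (rcons_tuple x i) = x.
Proof.
apply: eq_from_tnth => j; rewrite tnth_mktuple !(tnth_nth 0%N) /= nth_rcons.
by rewrite size_tuple ltn_ord.
Qed.

Lemma final_rcons (n : nat) (x : n.-tuple nat) (i : nat) :
  final (rcons_tuple x i) = i.
Proof.
by rewrite /final (tnth_nth 0%N) /= nth_rcons size_tuple ltnn eqxx.
Qed.

Section GoodClass.
Local Open Scope nat_scope.
Variables (C : function_class) (hC : good_class C).
Arguments C : clear implicits.

Lemma in_class_eq (n : nat) (f g : n.-tuple nat -> nat) :
  C n f -> f =1 g -> C n g.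
Proof. by move=> Cf /funext <-. Qed.

Lemma in_class_cst (n k : nat) : C n (fun=> k).
Proof. exact: good_const. Qed.

Lemma in_class_front (n : nat) (f : n.-tuple nat -> nat) :
  C n f -> C n.+1 (fun y => f (front y)).
Proof.
move=> Cf; apply: (good_comp hC Cf) => i; exact: good_proj.
Qed.

Lemma in_class_final (n : nat) : C n.+1 (@final n).
Proof. exact: good_proj. Qed.

Lemma in_class_monus (n : nat) (a b : n.-tuple nat -> nat) :
  C n a -> C n b -> C n (fun x => a x - b x).
Proof.
move=> Ca Cb.
pose g (i : 'I_2) := if i == ord0 then a else b.
have Cg i : C n (g i) by rewrite /g; case: ifP.
apply: (in_class_eq (good_comp hC (good_monus hC) Cg)) => x.
by rewrite !tnth_mktuple.
Qed.

Lemma in_class_succ (n : nat) (a : n.-tuple nat -> nat) :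
  C n a -> C n (fun x => (a x).+1).
Proof.
move=> Ca.
have := good_comp (g := fun i : 'I_1 => a) hC (good_succ hC).
move=> /(_ (fun _ => Ca))/in_class_eq; apply=> x; by rewrite tnth_mktuple.
Qed.

(** [good_sum] takes its own last argument as the bound; composing it with the tuple [x] extended by
    [b x] admits any bound from the class. *)
Lemma in_class_sum_le (n : nat) (b : n.-tuple nat -> nat)
    (G : n.-tuple nat -> nat -> nat) :
  C n b -> C n.+1 (fun y => G (front y) (final y)) ->
  C n (fun x => \sum_(0 <= i < (b x).+1) G x i).
Proof.
move=> Cb CG.
pose f (y : n.+1.-tuple nat) := \sum_(0 <= i < (final y).+1) G (front y) i.
have Cf : C n.+1 f.
  apply: (good_sum hC CG) => x y; rewrite /f final_rcons front_rcons.
  by apply: eq_bigr => i _; rewrite front_rcons final_rcons.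
pose g (i : 'I_n.+1) (x : n.-tuple nat) := tnth (rcons_tuple x (b x)) i.
have Cg i : C n (g i).
  have [lin|] := ltnP i n.
    apply: (in_class_eq (good_proj hC (Ordinal lin))) => x.
    by rewrite /g !(tnth_nth 0) /= nth_rcons size_tuple lin.
  move=> lni; apply: (in_class_eq Cb) => x.
  have -> : i = ord_max by apply/val_inj/anti_leq; rewrite lni -ltnS ltn_ord.
  exact/esym/final_rcons.
apply: (in_class_eq (good_comp hC Cf Cg)) => x.
rewrite /g; have -> : [tuple tnth (rcons_tuple x (b x)) i | i < n.+1]
    = rcons_tuple x (b x) by apply: eq_from_tnth => i; rewrite tnth_mktuple.
by rewrite /f final_rcons front_rcons.
Qed.

Lemma in_class_mulS (n : nat) (a b : n.-tuple nat -> nat) :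
  C n a -> C n b -> C n (fun x => a x * (b x).+1).
Proof.
move=> Ca Cb; have := in_class_sum_le (G := fun x _ => a x) Cb.
move=> /(_ (in_class_front Ca))/in_class_eq; apply=> x.
by rewrite sum_nat_const_nat subn0 mulnC.
Qed.

Lemma in_class_mul (n : nat) (a b : n.-tuple nat -> nat) :
  C n a -> C n b -> C n (fun x => a x * b x).
Proof.
move=> Ca Cb; apply: (in_class_eq (in_class_monus (in_class_mulS Ca Cb) Ca)).
by move=> x /=; rewrite mulnS addnC addnK.
Qed.

(** Addition is obtained after multiplication, as [(a + 1) * (b + 1) - a * b - 1]; multiplication
    itself is a sum of equal terms. *)
Lemma in_class_add (n : nat) (a b : n.-tuple nat -> nat) :
  C n a -> C n b -> C n (fun x => a x + b x).
Proof.
move=> Ca Cb.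
apply: (in_class_eq (in_class_monus (in_class_monus
  (in_class_mulS (in_class_succ Ca) Cb) (in_class_mul Ca Cb))
  (in_class_cst n 1))) => x /=; lia.
Qed.

Lemma in_class_exp (n k : nat) (a : n.-tuple nat -> nat) :
  C n a -> C n (fun x => a x ^ k).
Proof.
move=> Ca; elim: k => [|k IHk]; first exact: in_class_cst.
by apply: (in_class_eq (in_class_mul Ca IHk)) => x; rewrite expnS.
Qed.

Lemma in_class_leq (n : nat) (a b : n.-tuple nat -> nat) :
  C n a -> C n b -> C n (fun x => a x <= b x : nat).
Proof.
move=> Ca Cb; apply: (in_class_eq (in_class_monus (in_class_cst n 1)
  (in_class_monus Ca Cb))) => x; lia.
Qed.

Lemma in_class_sum (n : nat) (b : n.-tuple nat -> nat)
    (G : n.-tuple nat -> nat -> nat) :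
  C n b -> C n.+1 (fun y => G (front y) (final y)) ->
  C n (fun x => \sum_(0 <= i < b x) G x i).
Proof.
move=> Cb CG.
have CG' : C n.+1 (fun y => (final y < b (front y)) * G (front y) (final y)).
  apply: in_class_mul CG; apply: in_class_leq (in_class_front Cb).
  exact/in_class_succ/in_class_final.
have := @in_class_sum_le n b (fun x i => (i < b x) * G x i) Cb CG'.
move=> /in_class_eq; apply=> x; rewrite big_nat_recr //= ltnn mul0n addn0.
by apply: eq_big_nat => i /andP[_ ->]; rewrite mul1n.
Qed.

Lemma in_class_eqn (n : nat) (a b : n.-tuple nat -> nat) :
  C n a -> C n b -> C n (fun x => a x == b x : nat).
Proof.
move=> Ca Cb; apply: (in_class_eq (in_class_mul (in_class_leq Ca Cb)
  (in_class_leq Cb Ca))) => x; rewrite eqn_leq.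
exact: mulnb.
Qed.

Lemma in_class_if (n : nat) (t : n.-tuple nat -> bool)
    (a b : n.-tuple nat -> nat) :
  C n (fun x => t x : nat) -> C n a -> C n b ->
  C n (fun x => if t x then a x else b x).
Proof.
move=> Ct Ca Cb.
apply: (in_class_eq (in_class_add (in_class_mul Ct Ca)
  (in_class_mul (in_class_monus (in_class_cst n 1) Ct) Cb))) => x.
by case: (t x); rewrite /= ?mul1n ?mul0n ?addn0.
Qed.

Lemma in_class_div (n : nat) (a b : n.-tuple nat -> nat) :
  C n a -> C n b -> C n (fun x => a x %/ b x).
Proof.
move=> Ca Cb.
have H : C n (fun x => \sum_(0 <= i < a x) ((i.+1 * b x <= a x) : nat)).
  apply: (in_class_sum (G := fun x i => (i.+1 * b x <= a x) : nat) Ca).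
  apply: in_class_leq (in_class_front Ca).
  exact: in_class_mul (in_class_succ (in_class_final n)) (in_class_front Cb).
(* The sum counts the positive multiples of [b x] up to [a x]. For [b x = 0] it counts every index,
   whereas [%/] returns 0; the factor [1 <= b x] corrects this. *)
apply: (in_class_eq (in_class_mul (in_class_leq (in_class_cst n 1) Cb) H)).
move=> x; case: (posnP (b x)) => [->|b_gt0]; first by rewrite divn0.
rewrite mul1n.
have le_qa : a x %/ b x <= a x by exact: leq_div.
rewrite (big_cat_nat (leq0n _) le_qa) /= [X in _ + X]big_nat_cond.
rewrite [X in _ + X]big1 ?addn0 => [|i /andP[/andP[qi _] _]].
  rewrite big_nat_cond (eq_bigr (fun=> 1)); last first.
    by move=> i /andP[/andP[_ iq] _]; rewrite -leq_divRL // iq.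
  by rewrite -big_nat_cond sum_nat_const_nat subn0 muln1.
by rewrite -leq_divRL // ltnNge qi.
Qed.

Lemma in_class_mod (n : nat) (a b : n.-tuple nat -> nat) :
  C n a -> C n b -> C n (fun x => a x %% b x).
Proof.
move=> Ca Cb.
apply: (in_class_eq (in_class_monus Ca (in_class_mul (in_class_div Ca Cb) Cb))).
by move=> x; rewrite {1}(divn_eq (a x) (b x)) addKn.
Qed.

Lemma in_class_odd (n : nat) (a : n.-tuple nat -> nat) :
  C n a -> C n (fun x => odd (a x) : nat).
Proof.
by move=> Ca; apply: (in_class_eq (in_class_mod Ca (in_class_cst n 2))) => x;
  rewrite modn2.
Qed.

Lemma in_class_dvdn (n : nat) (a b : n.-tuple nat -> nat) :
  C n a -> C n b -> C n (fun x => a x %| b x : nat).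
Proof.
move=> Ca Cb; exact: in_class_eqn (in_class_mod Cb Ca) (in_class_cst n 0).
Qed.

(** A positive integer is a power of two exactly when 1 is its only odd divisor. Counting odd
    divisors is a bounded sum, so the test stays in the class. *)
Definition is_pow2 (p : nat) : bool :=
  \sum_(0 <= d < p.+1) (d %| p) * odd d == 1.

Lemma is_pow2P (p : nat) : 0 < p -> reflect (exists k, p = 2 ^ k) (is_pow2 p).
Proof.
move=> p_gt0; rewrite /is_pow2.
have split1 : \sum_(0 <= d < p.+1) (d %| p) * odd d =
    (\sum_(2 <= d < p.+1) (d %| p) * odd d).+1.
  rewrite big_ltn // dvd0n (gtn_eqF p_gt0) mul0n add0n big_ltn //.
  by rewrite dvd1n.
rewrite split1 eqSS sum_nat_seq_eq0.
apply: (iffP allP) => [H|[k ->] d].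
  exists (logn 2 p); have [q] := pfactor_coprime (isT : prime 2) p_gt0.
  rewrite coprime2n => q_odd def_p.
  have q_dvd : q %| p by rewrite def_p dvdn_mulr.
  have [q_le1|q_gt1] := leqP q 1.
    rewrite [LHS]def_p; have -> : q = 1 by move: q_odd q_le1; case: (q) => [|[]].
    by rewrite mul1n.
  have := H q; rewrite mem_index_iota q_gt1 ltnS dvdn_leq // q_dvd q_odd.
  by move=> /(_ isT).
rewrite mem_index_iota => /andP[d_gt1 _] /=.
case: (boolP (d %| _)) => //= /(dvdn_pfactor _ _ (isT : prime 2))[j _ d_eq].
by move: d_gt1; rewrite d_eq; case: j {d_eq} => //= j _; rewrite expnS oddM.
Qed.

Lemma in_class_is_pow2 (n : nat) (a : n.-tuple nat -> nat) :
  C n a -> C n (fun x => is_pow2 (a x) : nat).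
Proof.
move=> Ca; apply: in_class_eqn (in_class_cst n 1).
apply: (in_class_sum (G := fun x d => (d %| a x) * odd d)).
  exact: in_class_succ.
apply: in_class_mul.
  exact: in_class_dvdn (in_class_final n) (in_class_front Ca).
exact/in_class_odd/in_class_final.
Qed.

(** The truncated logarithm jumps by one exactly at the powers of two, so counting these replaces
    any exponentiation. *)
Lemma trunc_log2_sum (y : nat) :
  trunc_log 2 y = \sum_(2 <= q < y.+1) is_pow2 q.
Proof.
elim: y => [|y IHy]; first by rewrite big_geq.
case: y IHy => [|y] IHy; first by rewrite big_geq.
rewrite big_nat_recr //= -IHy.
case: is_pow2P => // [[k yk]|npow].
  rewrite yk trunc_expnK // addn1.
  case: k yk => [//|k] yk; congr _.+1.
  apply/esym/trunc_log_eq => //.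
  by rewrite -yk ltnSn andbT; move: yk (expn_gt0 2 k); rewrite expnS; lia.
rewrite addn0; apply: trunc_log_eq => //.
have /andP[lo hi] := trunc_log_bounds (isT : 1 < 2) (isT : 0 < y.+1).
rewrite (leq_trans lo) //= ltn_neqAle hi andbT.
by apply/eqP => E; apply: npow; exists (trunc_log 2 y.+1).+1.
Qed.

Lemma in_class_trunc_log2 (n : nat) (a : n.-tuple nat -> nat) :
  C n a -> C n (fun x => trunc_log 2 (a x)).
Proof.
move=> Ca.
have H : C n (fun x => \sum_(0 <= q < (a x).+1) (2 <= q) * is_pow2 q).
  apply: (in_class_sum (G := fun x q => (2 <= q) * is_pow2 q)).
    exact: in_class_succ.
  apply: in_class_mul; last exact/in_class_is_pow2/in_class_final.
  exact: in_class_leq (in_class_cst _ 2) (in_class_final n).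
apply: (in_class_eq H) => x; rewrite trunc_log2_sum.
rewrite (big_nat_widenl 2 0) // big_mkcond /= .
by apply: eq_bigr => q _; case: leqP; rewrite ?mul1n ?mul0n.
Qed.

(* [2 ^ i] itself may outgrow the class; a bound [P] makes it available. *)
Definition pow2_below (P i : nat) : nat :=
  \sum_(1 <= p < P.+1) (is_pow2 p * (trunc_log 2 p == i)) * p.

Lemma pow2_belowE (P i : nat) : 2 ^ i <= P -> pow2_below P i = 2 ^ i.
Proof.
move=> le_iP; rewrite /pow2_below.
have i_in : 2 ^ i \in index_iota 1 P.+1.
  by rewrite mem_index_iota expn_gt0.
rewrite (bigD1_seq _ i_in (iota_uniq _ _)) /=.
rewrite [X in _ + X]big_seq_cond [X in _ + X]big1 => [|p].
  rewrite trunc_expnK // eqxx; rewrite addn0.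
  have -> : is_pow2 (2 ^ i) by apply/is_pow2P; [rewrite expn_gt0|exists i].
  by rewrite mul1n.
rewrite mem_index_iota => /andP[/andP[p_gt0 _] neq].
case: is_pow2P => // -[k pk]; move: neq; rewrite pk trunc_expnK //.
by case: (eqVneq k i) => [->|]; rewrite ?eqxx.
Qed.

Lemma in_class_pow2_below (n : nat) (P i : n.-tuple nat -> nat) :
  C n P -> C n i -> C n (fun x => pow2_below (P x) (i x)).
Proof.
move=> CP Ci.
have H : C n (fun x => \sum_(0 <= p < (P x).+1)
    (is_pow2 p * (trunc_log 2 p == i x)) * p).
  apply: (in_class_sum
    (G := fun x p => (is_pow2 p * (trunc_log 2 p == i x)) * p)).
    exact: in_class_succ.
  apply: in_class_mul (in_class_final n).
  apply: in_class_mul; first exact/in_class_is_pow2/in_class_final.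
  apply: in_class_eqn (in_class_front Ci).
  exact/in_class_trunc_log2/in_class_final.
apply: (in_class_eq H) => x.
by rewrite big_ltn // muln0 add0n.
Qed.

Definition popcount (n u : nat) : nat := \sum_(0 <= i < n) odd (u %/ 2 ^ i).

Lemma popcountS (n u : nat) (b : bool) :
  popcount n.+1 (u.*2 + b) = b + popcount n u.
Proof.
rewrite /popcount big_nat_recl // expn0 divn1 oddD odd_double oddb.
congr (_ + _); apply: eq_bigr => i _.
by rewrite expnS divnMA divn2 halfD odd_double doubleK; case: b; rewrite /= addn0.
Qed.

Lemma sum_double (f : nat -> nat) (M : nat) :
  \sum_(0 <= u < M.*2) f u = \sum_(0 <= u < M) (f u.*2 + f u.*2.+1).
Proof.
elim: M => [|M IHM]; first by rewrite !big_nil.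
by rewrite doubleS !big_nat_recr //= IHM addnA.
Qed.

(** Splitting the words by their lowest binary digit turns the count into Pascal's rule. *)
Lemma popcount_bin (n k : nat) :
  \sum_(0 <= u < 2 ^ n) (popcount n u == k) = 'C(n, k).
Proof.
elim: n k => [|n IHn] k.
  by rewrite expn0 big_nat1 /popcount big_nil bin0n eq_sym.
rewrite expnS mul2n sum_double big_split /=.
have E0 u : popcount n.+1 u.*2 = popcount n u.
  by have := popcountS n u false; rewrite addn0.
have E1 u : popcount n.+1 u.*2.+1 = (popcount n u).+1.
  by have := popcountS n u true; rewrite addn1.
under eq_bigr do rewrite E0.
under [X in _ + X]eq_bigr do rewrite E1.
rewrite IHn; case: k => [|k].
  by rewrite !bin0 big1 // addn0.
by rewrite binS; congr (_ + _); exact: IHn.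
Qed.

(** The count of [popcount_bin], with all powers of two drawn from [pow2_below]: one bound [P]
    serves both the range of words and the place values. *)
Definition bin_below (P n k : nat) : nat :=
  \sum_(0 <= u < pow2_below P n)
    (\sum_(0 <= i < n) odd (u %/ pow2_below P i) == k).

Lemma bin_belowE (P n k : nat) : 2 ^ n <= P -> bin_below P n k = 'C(n, k).
Proof.
move=> le_nP; rewrite /bin_below pow2_belowE // -popcount_bin.
apply: eq_bigr => u _; congr (nat_of_bool (_ == _)).
apply: eq_big_nat => i /andP[_ lt_in]; rewrite pow2_belowE //.
by rewrite (leq_trans _ le_nP) // leq_exp2l // ltnW.
Qed.

Lemma in_class_bin_below (n : nat) (P m k : n.-tuple nat -> nat) :
  C n P -> C n m -> C n k -> C n (fun x => bin_below (P x) (m x) (k x)).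
Proof.
move=> CP Cm Ck.
apply: (in_class_sum (G := fun x u =>
  (\sum_(0 <= i < m x) odd (u %/ pow2_below (P x) i) == k x) : nat)).
  exact: in_class_pow2_below.
apply: in_class_eqn (in_class_front Ck).
apply: (in_class_sum (G := fun y i =>
  odd (final y %/ pow2_below (P (front y)) i) : nat)).
  exact: in_class_front.
apply: in_class_odd; apply: in_class_div.
  exact/in_class_front/in_class_final.
apply: in_class_pow2_below (in_class_final _).
exact: (in_class_front (in_class_front CP)).
Qed.

End GoodClass.

(** * The sum norm on complex numbers *)

Section SumNorm.
Variable R : realType.
Local Notation K := (R[i]).
Implicit Types (x y z p q : K).

(** The norm of [R[i]] takes values in [R[i]]. This equivalent norm is real-valued,
    submultiplicative and free of square roots, which leaves estimates within reach of linear
    arithmetic. *)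
Definition cnorm z : R := `|complex.Re z| + `|complex.Im z|.

Lemma ReD x y : complex.Re (x + y) = complex.Re x + complex.Re y.
Proof. by case: x; case: y. Qed.
Lemma ImD x y : complex.Im (x + y) = complex.Im x + complex.Im y.
Proof. by case: x; case: y. Qed.
Lemma ReN x : complex.Re (- x) = - complex.Re x.
Proof. by case: x. Qed.
Lemma ImN x : complex.Im (- x) = - complex.Im x.
Proof. by case: x. Qed.
Lemma ReM x y : complex.Re (x * y) =
  complex.Re x * complex.Re y - complex.Im x * complex.Im y.
Proof. by case: x; case: y. Qed.
Lemma ImM x y : complex.Im (x * y) =
  complex.Re x * complex.Im y + complex.Im x * complex.Re y.
Proof. by case: x; case: y. Qed.
Lemma ReV x : complex.Re x^-1 =
  complex.Re x / (complex.Re x ^+ 2 + complex.Im x ^+ 2).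
Proof. by case: x. Qed.
Lemma ImV x : complex.Im x^-1 =
  - complex.Im x / (complex.Re x ^+ 2 + complex.Im x ^+ 2).
Proof. by case: x => a b; rewrite mulNr. Qed.

Lemma complex_ext x y : complex.Re x = complex.Re y ->
  complex.Im x = complex.Im y -> x = y.
Proof. by case: x => a b; case: y => c d /= -> ->. Qed.

Lemma cnorm_ge0 z : 0 <= cnorm z.
Proof. exact: addr_ge0. Qed.

Lemma cnorm0 : cnorm 0 = 0.
Proof. by rewrite /cnorm /= normr0 addr0. Qed.

Lemma cnorm0_eq0 z : cnorm z = 0 -> z = 0.
Proof.
move=> /eqP; rewrite paddr_eq0 // !normr_eq0 => /andP[/eqP z0 /eqP z1].
exact: complex_ext.
Qed.

Lemma cnorm_gt0 z : z != 0 -> 0 < cnorm z.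
Proof.
move=> z0; rewrite lt_def cnorm_ge0 andbT.
by apply: contra_neq z0; exact: cnorm0_eq0.
Qed.

Lemma cnormN z : cnorm (- z) = cnorm z.
Proof. by rewrite /cnorm ReN ImN !normrN. Qed.

Lemma cnormBC x y : cnorm (x - y) = cnorm (y - x).
Proof. by rewrite -cnormN opprB. Qed.

Lemma cnormD x y : cnorm (x + y) <= cnorm x + cnorm y.
Proof.
rewrite /cnorm ReD ImD.
have := ler_normD (complex.Re x) (complex.Re y).
have := ler_normD (complex.Im x) (complex.Im y); lra.
Qed.

Lemma cnormB x y : cnorm (x - y) <= cnorm x + cnorm y.
Proof. by rewrite -(cnormN y); exact: cnormD. Qed.

Lemma cnormM x y : cnorm (x * y) <= cnorm x * cnorm y.
Proof.
rewrite /cnorm ReM ImM mulrDl !mulrDr -!normrM.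
have := ler_normB (complex.Re x * complex.Re y) (complex.Im x * complex.Im y).
have := ler_normD (complex.Re x * complex.Im y) (complex.Im x * complex.Re y).
lra.
Qed.

(** Inversion costs a constant because the norm is only submultiplicative; 2 comes from
    [(|a| + |b|) ^ 2 <= 2 (a ^ 2 + b ^ 2)]. *)
Lemma cnormV z : cnorm z^-1 <= 2 / cnorm z.
Proof.
have [->|z0] := eqVneq z 0; first by rewrite invr0 cnorm0 invr0 mulr0.
have n0 := cnorm_gt0 z0; rewrite ler_pdivlMr // /cnorm ReV ImV mulNr normrN.
set a := complex.Re z; set b := complex.Im z.
have s0 : 0 < a ^+ 2 + b ^+ 2.
  rewrite lt_def addr_ge0 ?sqr_ge0 // andbT paddr_eq0 ?sqr_ge0 //.
  rewrite !sqrf_eq0; apply: contra z0 => /andP[/eqP a0 /eqP b0].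
  by apply/eqP/complex_ext.
rewrite !normrM normfV (gtr0_norm s0) -mulrDl mulrAC ler_pdivrMr //.
rewrite -(real_normK (num_real a)) -(real_normK (num_real b)).
by have := sqr_ge0 (`|a| - `|b|); lra.
Qed.

Lemma Re_le_cnorm z : `|complex.Re z| <= cnorm z.
Proof. by rewrite lerDl. Qed.

Lemma Im_le_cnorm z : `|complex.Im z| <= cnorm z.
Proof. by rewrite lerDr. Qed.

Lemma normc_le_cnorm z : ComplexField.Normc.normc z <= cnorm z.
Proof.
case: z => a b; rewrite /cnorm /= -[leRHS]ger0_norm ?addr_ge0 //.
rewrite -sqrtr_sqr ler_wsqrtr // sqrrD !real_normK ?num_real //.
by rewrite lerD2r lerDl mulrn_wge0 // mulr_ge0.
Qed.

Lemma cnorm_le_normc z : cnorm z <= 2 * ComplexField.Normc.normc z.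
Proof.
case: z => a b; rewrite /cnorm /= mulr_natl mulr2n.
by apply: lerD; rewrite -sqrtr_sqr ler_wsqrtr // ?lerDl ?lerDr sqr_ge0.
Qed.

Lemma nbhs_cnormP (p : R[i]^o) (A : set R[i]^o) :
  nbhs p A <-> exists2 dl : R, 0 < dl &
                 forall q : R[i]^o, cnorm (q - p) < dl -> A q.
Proof.
split=> [/nbhs_normP[[a b]] /=|[dl dl0 H]].
  rewrite ltcE /= => /andP[/eqP-> a0] H; exists a => // q qp; apply: H.
  rewrite /ball_ /= distrC ltcE /= eqxx /=; apply: le_lt_trans qp.
  exact: normc_le_cnorm.
apply: (proj2 (nbhs_normP p A)); exists (dl / 2)%:C%C => /=.
  by rewrite ltcE /= eqxx divr_gt0.
move=> q; rewrite /ball_ /= distrC ltcE /= eqxx /= => qp; apply: H.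
apply: le_lt_trans (cnorm_le_normc _) _.
by rewrite -ltr_pdivlMl // mulrC.
Qed.

Definition ccont (g : K -> K) p := forall eps : R, 0 < eps ->
  exists2 dl : R, 0 < dl & forall q,
    cnorm (q - p) < dl -> cnorm (g q - g p) < eps.

(* Caratheodory's form of complex differentiability. *)
Definition cdiff (g : K -> K) p := exists2 phi, ccont phi p &
  exists2 dl : R, 0 < dl & forall q, cnorm (q - p) < dl ->
    g q - g p = phi q * (q - p).

Lemma ccont_near (g : K -> K) p : ccont g p ->
  exists2 dl : R, 0 < dl & forall q, cnorm (q - p) < dl ->
    cnorm (g q) <= cnorm (g p) + 1.
Proof.
move=> /(_ 1 ltr01)[dl dl0 H]; exists dl => // q /H/ltW gq.
by rewrite -[g q](subrK (g p)); apply: le_trans (cnormD _ _) _; lra.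
Qed.

Lemma ccont_cst (c p : K) : ccont (fun=> c) p.
Proof. by move=> eps eps0; exists 1 => // q _; rewrite subrr cnorm0. Qed.

Lemma ccont_id p : ccont id p.
Proof. by move=> eps eps0; exists eps. Qed.

Lemma ccontD (f g : K -> K) p : ccont f p -> ccont g p ->
  ccont (fun q => f q + g q) p.
Proof.
move=> cf cg eps eps0; have e2 : 0 < eps / 2 by rewrite divr_gt0.
have [d1 d10 H1] := cf _ e2; have [d2 d20 H2] := cg _ e2.
exists (Num.min d1 d2); first by rewrite lt_min d10.
move=> q; rewrite lt_min => /andP[/H1 fq /H2 gq].
have -> : f q + g q - (f p + g p) = (f q - f p) + (g q - g p) by ring.
by apply: le_lt_trans (cnormD _ _) _; lra.
Qed.

Lemma ccontM (f g : K -> K) p : ccont f p -> ccont g p ->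
  ccont (fun q => f q * g q) p.
Proof.
move=> cf cg eps eps0; have [d0 d00 H0] := ccont_near cf.
pose M := cnorm (f p) + cnorm (g p) + 1.
have M0 : 0 < M by have := cnorm_ge0 (f p); have := cnorm_ge0 (g p); rewrite /M; lra.
have e2 : 0 < eps / (2 * M) by rewrite divr_gt0 ?mulr_gt0.
have [d1 d10 H1] := cf _ e2; have [d2 d20 H2] := cg _ e2.
exists (Num.min d0 (Num.min d1 d2)); first by rewrite !lt_min d00 d10.
move=> q; rewrite !lt_min => /and3P[/H0 f0q /H1 fq /H2 gq].
have -> : f q * g q - f p * g p = f q * (g q - g p) + (f q - f p) * g p by ring.
apply: le_lt_trans (cnormD _ _) _.
have A1 : cnorm (f q * (g q - g p)) <= M * cnorm (g q - g p).
  apply: le_trans (cnormM _ _) _; rewrite ler_wpM2r ?cnorm_ge0 //.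
  by have := cnorm_ge0 (g p); rewrite /M; lra.
have A2 : cnorm ((f q - f p) * g p) <= M * cnorm (f q - f p).
  apply: le_trans (cnormM _ _) _; rewrite mulrC ler_wpM2r ?cnorm_ge0 //.
  by have := cnorm_ge0 (f p); rewrite /M; lra.
have -> : eps = M * (eps / (2 * M)) + M * (eps / (2 * M)).
  by field; rewrite gt_eqF.
rewrite -(ltr_pM2l M0) in fq; rewrite -(ltr_pM2l M0) in gq; lra.
Qed.

Lemma ccontV (g : K -> K) p : g p != 0 -> ccont g p ->
  ccont (fun q => (g q)^-1) p.
Proof.
move=> gp cg eps eps0; set m := cnorm (g p).
have m0 : 0 < m by exact: cnorm_gt0.
(* Within [m / 2] of [g p] the value [g q] has norm at least [m / 2]; by [cnormV] the two inverses
   then contribute at most [(2 / (m / 2)) * (2 / m) = 8 / m ^ 2], which the second radius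
   compensates. *)
have [d1 d10 H1] : exists2 dl, 0 < dl & forall q, cnorm (q - p) < dl ->
    cnorm (g q - g p) < m / 2 by apply: cg; rewrite divr_gt0.
have [d2 d20 H2] : exists2 dl, 0 < dl & forall q, cnorm (q - p) < dl ->
    cnorm (g q - g p) < eps * (m ^+ 2 / 8).
  by apply: cg; rewrite mulr_gt0 // divr_gt0 // exprn_gt0.
exists (Num.min d1 d2); first by rewrite lt_min d10.
move=> q; rewrite lt_min => /andP[/H1 gq1 /H2 gq2].
have mq : m / 2 <= cnorm (g q).
  have := cnormB (g q) (g q - g p); rewrite opprB addrC subrK -/m; lra.
have gq0 : g q != 0.
  by apply: contraTneq mq => ->; rewrite cnorm0 -ltNge divr_gt0.
have -> : (g q)^-1 - (g p)^-1 = - ((g q - g p) * ((g q)^-1 * (g p)^-1)).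
  by field; rewrite gq0 gp.
rewrite cnormN; apply: le_lt_trans (cnormM _ _) _.
have V : cnorm ((g q)^-1 * (g p)^-1) <= 8 / m ^+ 2.
  apply: le_trans (cnormM _ _) _.
  have -> : 8 / m ^+ 2 = (2 / (m / 2)) * (2 / m) by field; rewrite gt_eqF.
  apply: ler_pM; rewrite ?cnorm_ge0 ?cnormV //.
  have gq00 := cnorm_gt0 gq0.
  by apply: le_trans (cnormV _) _; rewrite ler_wpM2l // lef_pV2 ?posrE ?divr_gt0.
apply: (@le_lt_trans _ _ (cnorm (g q - g p) * (8 / m ^+ 2))).
  by rewrite ler_wpM2l // cnorm_ge0.
rewrite -ltr_pdivlMr ?divr_gt0 ?exprn_gt0 // invf_div //.
Qed.

Lemma ccont_subr p c : ccont (fun q => q - c) p.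
Proof. by apply: ccontD; [exact: ccont_id|exact: ccont_cst]. Qed.

Lemma cdiff_ccont (g : K -> K) p : cdiff g p -> ccont g p.
Proof.
move=> [phi cphi [dl dl0 H]] eps eps0; have [d1 d10 H1] := ccont_near cphi.
set M := cnorm (phi p) + 1 in H1.
have M0 : 0 < M by have := cnorm_ge0 (phi p); rewrite /M; lra.
exists (Num.min dl (Num.min d1 (eps / M))).
  by rewrite !lt_min dl0 d10 divr_gt0.
move=> q; rewrite !lt_min => /and3P[/H -> /H1 phq qp].
apply: le_lt_trans (cnormM _ _) _.
apply: (@le_lt_trans _ _ (M * cnorm (q - p))).
  by rewrite ler_wpM2r // cnorm_ge0.
by rewrite mulrC -ltr_pdivlMr.
Qed.

Lemma cdiff_affine (g : K -> K) p : cdiff g p ->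
  exists l : K, forall eps : R, 0 < eps -> exists2 dl : R, 0 < dl & forall q,
    cnorm (q - p) < dl ->
    cnorm (g q - (g p + l * (q - p))) <= eps * cnorm (q - p).
Proof.
move=> [phi cphi [dl dl0 H]]; exists (phi p) => eps eps0.
have [d1 d10 H1] := cphi _ eps0.
exists (Num.min dl d1); first by rewrite lt_min dl0.
move=> q; rewrite lt_min => /andP[/H gq /H1/ltW phq].
rewrite opprD addrA gq -mulrBl; apply: le_trans (cnormM _ _) _.
by rewrite ler_wpM2r // cnorm_ge0.
Qed.

Lemma cdiff_cst (c p : K) : cdiff (fun=> c) p.
Proof.
exists (fun=> 0); first exact: ccont_cst.
by exists 1 => // q _; rewrite subrr mul0r.
Qed.

Lemma cdiff_subr (f : K -> K) (c p : K) :
  cdiff f p -> cdiff (fun q => f q - c) p.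
Proof.
move=> [phi cphi [dl dl0 H]]; exists phi => //; exists dl => // q /H <-.
by ring.
Qed.

Lemma cdiff_quot (f : K -> K) (c p : K) : p != c -> cdiff f p ->
  cdiff (fun q => f q / (q - c)) p.
Proof.
move=> pc [phi cphi [dl dl0 H]]; have pc0 : p - c != 0 by rewrite subr_eq0.
(* The slope of the quotient, solved from [f q = f p + phi q * (q - p)]; the radius [cnorm (p - c)]
   taken below keeps [q] off the pole. *)
exists (fun q => (phi q - f p / (p - c)) * (q - c)^-1).
  apply: ccontM; first by apply: ccontD => //; exact: ccont_cst.
  by apply: ccontV => //; exact: ccont_subr.
exists (Num.min dl (cnorm (p - c))); first by rewrite lt_min dl0 cnorm_gt0.
move=> q; rewrite lt_min => /andP[/H fq qpc].
have qc0 : q - c != 0.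
  by apply: contraTneq qpc => /subr0_eq ->; rewrite cnormBC ltxx.
have -> : f q = f p + phi q * (q - p) by rewrite -fq addrC subrK.
by field; rewrite qc0 pc0.
Qed.

Lemma derivable_cdiff (g : R[i]^o -> R[i]^o) (p : R[i]^o) :
  derivable g p 1 -> cdiff g p.
Proof.
move=> /cvg_ex[l gl].
(* The difference quotient, completed at [p] by the derivative. *)
exists (fun q => if q == p then l else (g q - g p) / (q - p)); last first.
  exists 1 => // q _; case: eqVneq => [->|qp]; first by rewrite !subrr mulr0.
  by rewrite divfK // subr_eq0.
move=> eps eps0; rewrite eqxx.
have /gl : nbhs (l : R[i]^o) [set w : R[i]^o | cnorm (w - l) < eps].
  by apply/nbhs_cnormP; exists eps.
rewrite /nbhs /= /dnbhs /within /= => /nbhs_cnormP[dl dl0 H].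
exists dl => // q qp; case: eqVneq => [_|q0]; first by rewrite subrr cnorm0.
have h0 : q - p != 0 by rewrite subr_eq0.
have := H (q - p); rewrite subr0 => /(_ qp h0) /=.
by rewrite /GRing.scale /= mulr1 subrK mulrC.
Qed.

End SumNorm.

(** * Integrals of complex-valued functions on segments *)

Section SegmentIntegral.
Variable R : realType.
Local Notation mu := (@lebesgue_measure R).
Implicit Types (a b m t : R) (f g : R -> R).

Definition rint a b f : R := \int[mu]_(t in `[a, b]) f t.

Definition cont_on a b f := forall t, a <= t <= b -> {for t, continuous f}.

Lemma cont_on_integrable a b f :
  cont_on a b f -> mu.-integrable `[a, b] (EFin \o f).
Proof.
move=> cf; apply: continuous_compact_integrable; first exact: segment_compact.
apply: continuous_in_subspaceT => t; rewrite inE /= in_itv /=; exact: cf.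
Qed.

Lemma cont_on_sub a b a' b' f : a <= a' -> b' <= b ->
  cont_on a b f -> cont_on a' b' f.
Proof.
move=> aa' bb' cf t /andP[a't tb']; apply: cf.
by rewrite (le_trans aa' a't) (le_trans tb' bb').
Qed.

Lemma rintD a b f g : cont_on a b f -> cont_on a b g ->
  rint a b (fun t => f t + g t) = rint a b f + rint a b g.
Proof.
by move=> cf cg; apply: RintegralD => //; exact: cont_on_integrable.
Qed.

Lemma rintZ a b (k : R) f : cont_on a b f ->
  rint a b (fun t => k * f t) = k * rint a b f.
Proof. by move=> cf; apply: RintegralZl => //; exact: cont_on_integrable. Qed.

Lemma rint_cst a b (k : R) : a <= b -> rint a b (fun=> k) = k * (b - a).
Proof.
move=> ab; rewrite /rint Rintegral_cst //= lebesgue_measure_itv /= lte_fin.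
case: ltP => // ba; rewrite (le_anti (introT andP (conj ab ba))).
by rewrite subrr.
Qed.

Lemma is_derive_half_sqr t : is_derive t 1 (fun s : R => s ^+ 2 / 2) t.
Proof.
have -> : (fun s : R => s ^+ 2 / 2) = (2^-1 \*: (@id R ^+ 2)).
  by apply/funext => s /=; rewrite mulrC.
by apply: is_derive_eq; rewrite expr1 /GRing.scale /=; field.
Qed.

Lemma rint_id a b : a <= b -> rint a b id = (b ^+ 2 - a ^+ 2) / 2.
Proof.
rewrite le_eqVlt => /predU1P[->|ab].
  by rewrite /rint set_itv1 Rintegral_set1 subrr mul0r.
rewrite /rint /Rintegral (@continuous_FTC2 _ _ (fun t => t ^+ 2 / 2)) //.
- by rewrite -EFinB /= mulrBl.
- by apply: continuous_subspaceT => t; exact: cvg_id.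
- have cF (t : R) : {for t, continuous (fun s : R => s ^+ 2 / 2)}.
    by have [dF _] := is_derive_half_sqr t;
      exact/differentiable_continuous/derivable1_diffP.
  split.
  + by move=> t _; case: (is_derive_half_sqr t).
  + by apply: cvg_at_right_filter; exact: cF.
  + by apply: cvg_at_left_filter; exact: cF.
- by move=> t _; have dF := is_derive_half_sqr t; rewrite derive1E derive_val.
Qed.

Lemma rint_split a m b f : a <= m -> m <= b -> cont_on a b f ->
  rint a b f = rint a m f + rint m b f.
Proof.
move=> am mb cf; apply/eqP; rewrite addrC -subr_eq; apply/eqP.
rewrite /rint (@Rintegral_itvB _ f (BLeft a) (BRight b) m); last 3 first.
- exact: cont_on_integrable.
- by rewrite bnd_simp.
- by rewrite bnd_simp.
rewrite Rintegral_itv_obnd_cbnd //.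
apply: (integrableS _ _ _ (cont_on_integrable (cont_on_sub am (lexx b) cf))) => //.
by move=> t /=; rewrite !in_itv /= => /andP[/ltW -> ->].
Qed.

Lemma le_rint a b f g : cont_on a b f -> cont_on a b g ->
  (forall t, a <= t <= b -> f t <= g t) -> rint a b f <= rint a b g.
Proof.
by move=> cf cg fg; apply: le_Rintegral => //; exact: cont_on_integrable.
Qed.

Lemma le_norm_rint a b f : cont_on a b f ->
  `|rint a b f| <= rint a b (fun t => `|f t|).
Proof. by move=> cf; apply: le_normr_Rintegral => //; exact: cont_on_integrable. Qed.

Definition ccont_on a b (f : R -> R[i]) :=
  cont_on a b (fun t => complex.Re (f t)) /\
  cont_on a b (fun t => complex.Im (f t)).

Definition cint a b (f : R -> R[i]) : R[i] :=
  (rint a b (fun t => complex.Re (f t)) +i* rint a b (fun t => complex.Im (f t)))%C.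

Lemma cintD a b (f g : R -> R[i]) : ccont_on a b f -> ccont_on a b g ->
  cint a b (fun t => f t + g t) = cint a b f + cint a b g.
Proof.
move=> [fr fi] [gr gi]; apply: complex_ext; rewrite /= ?ReD ?ImD /=.
  by rewrite -rintD //; congr rint; apply/funext => t; rewrite ReD.
by rewrite -rintD //; congr rint; apply/funext => t; rewrite ImD.
Qed.

Lemma cont_onZ a b (k : R) f : cont_on a b f -> cont_on a b (fun t => k * f t).
Proof. by move=> cf t /cf ft; apply: cvgM => //; exact: cvg_cst. Qed.

Lemma cintZ a b (k : R[i]) (f : R -> R[i]) : ccont_on a b f ->
  cint a b (fun t => k * f t) = k * cint a b f.
Proof.
move=> [fr fi]; apply: complex_ext; rewrite ?ReM ?ImM /= -!rintZ //.
  rewrite -mulN1r -rintZ; last exact: cont_onZ.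
  rewrite -rintD; [|exact: cont_onZ|do 2 apply: cont_onZ; exact: fi].
  by congr rint; apply/funext => t; rewrite ReM mulN1r.
rewrite -rintD; [|exact: cont_onZ|exact: cont_onZ].
by congr rint; apply/funext => t; rewrite ImM.
Qed.

Lemma cint_split a m b (f : R -> R[i]) : a <= m -> m <= b -> ccont_on a b f ->
  cint a b f = cint a m f + cint m b f.
Proof.
by move=> am mb [fr fi]; apply: complex_ext; rewrite ?ReD ?ImD /= (@rint_split a m b).
Qed.

(** With the sum norm, the real bounds for the two components add up under a single integral, so no
    constant is lost. *)
Lemma cnorm_cint a b (M : R) (f : R -> R[i]) : a <= b -> ccont_on a b f ->
  (forall t, a <= t <= b -> cnorm (f t) <= M) ->
  cnorm (cint a b f) <= M * (b - a).
Proof.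
move=> ab [fr fi] fM; rewrite /cnorm /=.
have nf g : cont_on a b g -> cont_on a b (fun t => `|g t|).
  by move=> cg t /cg gt; apply: cvg_norm.
apply: le_trans (lerD (le_norm_rint fr) (le_norm_rint fi)) _.
rewrite -rintD; [|exact: nf|exact: nf].
rewrite -rint_cst //; apply: le_rint => // t.
- by move=> abt; apply: cvgD; apply: nf.
- by move=> _; exact: cvg_cst.
Qed.

Lemma cint_affine a b (x y : R[i]) : a <= b ->
  cint a b (fun t => x + y * (t%:C)%C) =
  x * ((b - a)%:C)%C + y * (((b ^+ 2 - a ^+ 2) / 2)%:C)%C.
Proof.
move=> ab.
have cc k : cont_on a b (fun=> k) by move=> t _; exact: cvg_cst.
have ci : cont_on a b id by move=> t _; exact: cvg_id.
apply: complex_ext; rewrite ?(ReD, ImD, ReM, ImM) /= !mulr0 ?subr0 ?add0r.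
  rewrite -(rint_id ab) -(rint_cst _ ab) -rintZ // -rintD //; last exact: cont_onZ.
  by congr rint; apply/funext => t; rewrite ReD ReM /= mulr0 subr0.
rewrite -(rint_id ab) -(rint_cst _ ab) -rintZ // -rintD //; last exact: cont_onZ.
by congr rint; apply/funext => t; rewrite ImD ImM /= mulr0 add0r.
Qed.

End SegmentIntegral.

(** * Cauchy's theorem for rectangles *)

Section RectangleIntegral.
Variable R : realType.
Local Notation K := (R[i]).
Implicit Types (a b c d m : R) (f g : K -> K) (z p q : K).

Definition in_rect a b c d z :=
  (a <= complex.Re z <= b) && (c <= complex.Im z <= d).

Definition rect_edge a b c d z := in_rect a b c d z /\
  [\/ complex.Re z = a, complex.Re z = b, complex.Im z = c | complex.Im z = d].

Definition edge_cont g a b c d := forall z, rect_edge a b c d z -> ccont g z.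

(** The counterclockwise contour integral: bottom minus top with [dz = dt], and right minus left
    with [dz = i dt]. *)
Definition rectint g a b c d : K :=
  cint a b (fun t => g (t +i* c)%C) - cint a b (fun t => g (t +i* d)%C) +
  'i%C * (cint c d (fun t => g (b +i* t)%C) - cint c d (fun t => g (a +i* t)%C)).

Lemma ccont_on_hor g a b c : (forall t, a <= t <= b -> ccont g (t +i* c)%C) ->
  ccont_on a b (fun t => g (t +i* c)%C).
Proof.
move=> cg; split=> t /cg gt; apply/(@cvgrPdist_lt _ R^o) => eps /gt[dl dl0 H];
  apply/nbhs_ballP; exists dl => // s; rewrite /ball /= distrC => ts;
  have /H gst : cnorm ((s +i* c)%C - (t +i* c)%C) < dl
    by rewrite /cnorm /= subrr normr0 addr0.
  rewrite distrC -ReN -ReD; exact: le_lt_trans (Re_le_cnorm _) gst.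
rewrite distrC -ImN -ImD; exact: le_lt_trans (Im_le_cnorm _) gst.
Qed.

Lemma ccont_on_ver g a c d : (forall t, c <= t <= d -> ccont g (a +i* t)%C) ->
  ccont_on c d (fun t => g (a +i* t)%C).
Proof.
move=> cg; split=> t /cg gt; apply/(@cvgrPdist_lt _ R^o) => eps /gt[dl dl0 H];
  apply/nbhs_ballP; exists dl => // s; rewrite /ball /= distrC => ts;
  have /H gst : cnorm ((a +i* s)%C - (a +i* t)%C) < dl
    by rewrite /cnorm /= subrr normr0 add0r.
  rewrite distrC -ReN -ReD; exact: le_lt_trans (Re_le_cnorm _) gst.
rewrite distrC -ImN -ImD; exact: le_lt_trans (Im_le_cnorm _) gst.
Qed.

Lemma edge_hor_lo a b c d t : c <= d -> a <= t <= b ->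
  rect_edge a b c d (t +i* c)%C.
Proof. by move=> cd abt; split; [rewrite /in_rect /= abt lexx|constructor 3]. Qed.

Lemma edge_hor_hi a b c d t : c <= d -> a <= t <= b ->
  rect_edge a b c d (t +i* d)%C.
Proof. by move=> cd abt; split; [rewrite /in_rect /= abt lexx cd|constructor 4]. Qed.

Lemma edge_ver_lo a b c d t : a <= b -> c <= t <= d ->
  rect_edge a b c d (a +i* t)%C.
Proof. by move=> ab cdt; split; [rewrite /in_rect /= cdt lexx ab|constructor 1]. Qed.

Lemma edge_ver_hi a b c d t : a <= b -> c <= t <= d ->
  rect_edge a b c d (b +i* t)%C.
Proof. by move=> ab cdt; split; [rewrite /in_rect /= cdt lexx ab|constructor 2]. Qed.

Lemma edge_cont_sides g a b c d : a <= b -> c <= d -> edge_cont g a b c d ->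
  [/\ ccont_on a b (fun t => g (t +i* c)%C), ccont_on a b (fun t => g (t +i* d)%C),
      ccont_on c d (fun t => g (a +i* t)%C) & ccont_on c d (fun t => g (b +i* t)%C)].
Proof.
move=> ab cd cg; split.
- by apply: ccont_on_hor => t abt; apply: cg; exact: edge_hor_lo.
- by apply: ccont_on_hor => t abt; apply: cg; exact: edge_hor_hi.
- by apply: ccont_on_ver => t cdt; apply: cg; exact: edge_ver_lo.
- by apply: ccont_on_ver => t cdt; apply: cg; exact: edge_ver_hi.
Qed.

Lemma eq_cint a b (f g : R -> K) : (forall t, a <= t <= b -> f t = g t) ->
  cint a b f = cint a b g.
Proof.
by move=> fg; congr (_ +i* _)%C; apply: eq_Rintegral => t;
  rewrite inE /= in_itv /= => /fg ->.
Qed.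

Lemma eq_rectint f g a b c d : a <= b -> c <= d ->
  (forall z, rect_edge a b c d z -> f z = g z) ->
  rectint f a b c d = rectint g a b c d.
Proof.
move=> ab cd fg; rewrite /rectint; congr (_ - _ + _ * (_ - _));
  apply: eq_cint => t It; apply: fg.
- exact: edge_hor_lo.
- exact: edge_hor_hi.
- exact: edge_ver_hi.
- exact: edge_ver_lo.
Qed.

Lemma rectintD f g a b c d : a <= b -> c <= d ->
  edge_cont f a b c d -> edge_cont g a b c d ->
  rectint (fun z => f z + g z) a b c d = rectint f a b c d + rectint g a b c d.
Proof.
move=> ab cd /(edge_cont_sides ab cd)[f1 f2 f3 f4].
move=> /(edge_cont_sides ab cd)[g1 g2 g3 g4].
by rewrite /rectint !cintD //; ring.
Qed.

Lemma rectintZ g (k : K) a b c d : a <= b -> c <= d -> edge_cont g a b c d ->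
  rectint (fun z => k * g z) a b c d = k * rectint g a b c d.
Proof.
move=> ab cd /(edge_cont_sides ab cd)[g1 g2 g3 g4].
by rewrite /rectint !cintZ //; ring.
Qed.

Lemma rectintB f g a b c d : a <= b -> c <= d ->
  edge_cont f a b c d -> edge_cont g a b c d ->
  rectint (fun z => f z - g z) a b c d = rectint f a b c d - rectint g a b c d.
Proof.
move=> ab cd cf cg; rewrite -[rectint g a b c d]mul1r -mulNr -rectintZ //.
rewrite -rectintD // => [|z Hz].
  by apply: eq_rectint => // z _; rewrite mulN1r.
by apply: ccontM; [exact: ccont_cst|exact: cg].
Qed.

Lemma cnorm_rectint g (M : R) a b c d : a <= b -> c <= d ->
  edge_cont g a b c d -> (forall z, rect_edge a b c d z -> cnorm (g z) <= M) ->
  cnorm (rectint g a b c d) <= M * (2 * (b - a) + 2 * (d - c)).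
Proof.
move=> ab cd /(edge_cont_sides ab cd)[g1 g2 g3 g4] gM; rewrite /rectint.
have H1 : cnorm (cint a b (fun t => g (t +i* c)%C)) <= M * (b - a).
  by apply: cnorm_cint => // t It; apply: gM; exact: edge_hor_lo.
have H2 : cnorm (cint a b (fun t => g (t +i* d)%C)) <= M * (b - a).
  by apply: cnorm_cint => // t It; apply: gM; exact: edge_hor_hi.
have H3 : cnorm (cint c d (fun t => g (a +i* t)%C)) <= M * (d - c).
  by apply: cnorm_cint => // t It; apply: gM; exact: edge_ver_lo.
have H4 : cnorm (cint c d (fun t => g (b +i* t)%C)) <= M * (d - c).
  by apply: cnorm_cint => // t It; apply: gM; exact: edge_ver_hi.
apply: le_trans (cnormD _ _) _.
have H5 := cnormB (cint a b (fun t => g (t +i* c)%C)) (cint a b (fun t => g (t +i* d)%C)).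
have H6 := cnormB (cint c d (fun t => g (b +i* t)%C)) (cint c d (fun t => g (a +i* t)%C)).
have H7 (w : K) : cnorm ('i%C * w) <= cnorm w.
  apply: le_trans (cnormM _ _) _.
  by rewrite {1}/cnorm /= normr0 normr1 add0r mul1r.
have := H7 (cint c d (fun t => g (b +i* t)%C) - cint c d (fun t => g (a +i* t)%C)).
lra.
Qed.

(** The one case of Cauchy's theorem that is computed outright; Goursat's argument reduces the
    general case to it. *)
Lemma rectint_affine (x y : K) a b c d : a <= b -> c <= d ->
  rectint (fun z => x + y * z) a b c d = 0.
Proof.
move=> ab cd; rewrite /rectint.
have h k : cint a b (fun t => x + y * (t +i* k)%C) =
    cint a b (fun t => (x + y * (0 +i* k)%C) + y * (t%:C)%C).
  apply: eq_cint => t _; rewrite -addrA -mulrDr; congr (_ + _ * _).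
  by apply: complex_ext; rewrite ?ReD ?ImD /= ?add0r ?addr0.
have v k : cint c d (fun t => x + y * (k +i* t)%C) =
    cint c d (fun t => (x + y * (k%:C)%C) + (y * 'i%C) * (t%:C)%C).
  apply: eq_cint => t _; rewrite -addrA -mulrA -mulrDr; congr (_ + _ * _).
  by apply: complex_ext; rewrite ?ReD ?ImD ?ReM ?ImM /=; ring.
by rewrite !h !v !cint_affine //; apply: complex_ext;
  rewrite !(ReD, ImD, ReN, ImN, ReM, ImM) /=; field.
Qed.

Lemma rectint_splitv g a m b c d : a <= m -> m <= b ->
  ccont_on a b (fun t => g (t +i* c)%C) -> ccont_on a b (fun t => g (t +i* d)%C) ->
  rectint g a b c d = rectint g a m c d + rectint g m b c d.
Proof.
move=> am mb h1 h2; rewrite /rectint.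
rewrite (cint_split am mb h1) (cint_split am mb h2); ring.
Qed.

Lemma rectint_splith g a b c m d : c <= m -> m <= d ->
  ccont_on c d (fun t => g (a +i* t)%C) -> ccont_on c d (fun t => g (b +i* t)%C) ->
  rectint g a b c d = rectint g a b c m + rectint g a b m d.
Proof.
move=> am mb h1 h2; rewrite /rectint.
rewrite (cint_split am mb h1) (cint_split am mb h2); ring.
Qed.

Lemma in_rect_sub a b c d a' b' c' d' z : a <= a' -> b' <= b -> c <= c' ->
  d' <= d -> in_rect a' b' c' d' z -> in_rect a b c d z.
Proof.
by move=> ? ? ? ? /andP[/andP[? ?] /andP[? ?]]; rewrite /in_rect; lra.
Qed.

Lemma rectint_quarters g a b c d m n : a <= m <= b -> c <= n <= d ->
  (forall z, in_rect a b c d z -> ccont g z) ->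
  rectint g a b c d = (rectint g a m c n + rectint g m b c n) +
                      (rectint g a m n d + rectint g m b n d).
Proof.
move=> /andP[am mb] /andP[cn nd] cg.
have ab := le_trans am mb; have cd := le_trans cn nd.
have hor k : c <= k <= d -> ccont_on a b (fun t => g (t +i* k)%C).
  by move=> ck; apply: ccont_on_hor => t abt; apply: cg; rewrite /in_rect /= abt.
have ver k : a <= k <= b -> ccont_on c d (fun t => g (k +i* t)%C).
  by move=> ck; apply: ccont_on_ver => t abt; apply: cg; rewrite /in_rect /= abt ck.
rewrite (rectint_splith cn nd); [|by apply: ver; rewrite lexx ab..].
by congr (_ + _); apply: rectint_splitv => //; apply: hor; rewrite ?cn ?lexx ?cd.
Qed.

(** Compactness in the form of an induction principle: a rectangle where [P] fails has a failing
    quarter, and the nested failing quarters shrink to a point that violates the local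
    hypothesis. *)
Lemma rect_bisection (P : R -> R -> R -> R -> Prop) a b c d :
  a <= b -> c <= d ->
  (forall a b c d, a <= b -> c <= d -> let m := (a + b) / 2 in
     let n := (c + d) / 2 in
     P a m c n -> P m b c n -> P a m n d -> P m b n d -> P a b c d) ->
  (forall x y, a <= x <= b -> c <= y <= d -> exists2 dl : R, 0 < dl &
     forall a' b' c' d', a' <= x <= b' -> c' <= y <= d' ->
       b' - a' < dl -> d' - c' < dl -> P a' b' c' d') ->
  P a b c d.
Proof.
move=> ab cd split_P local_P; apply: contrapT => nP.
pose Q (q : R * R * (R * R)) := P q.1.1 q.1.2 q.2.1 q.2.2.
(* Moves to the first failing quarter. The last branch is taken untested: if [P] held on all four
   quarters, it would hold on the whole. *)
pose step (q : R * R * (R * R)) :=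
  let: ((a, b), (c, d)) := q in let m := (a + b) / 2 in let n := (c + d) / 2 in
  if ~~ `[< P a m c n >] then ((a, m), (c, n)) else
  if ~~ `[< P m b c n >] then ((m, b), (c, n)) else
  if ~~ `[< P a m n d >] then ((a, m), (n, d)) else ((m, b), (n, d)).
pose s k := iter k step ((a, b), (c, d)).
have inv k : [/\ (s k).1.1 <= (s k).1.2, (s k).2.1 <= (s k).2.2 & ~ Q (s k)].
  elim: k => [|k]; first by split.
  rewrite /s iterS -/(s k); case: (s k) => [[a1 b1] [c1 d1]] /= [ab1 cd1 nP1].
  have [m1 m2] : a1 <= (a1 + b1) / 2 /\ (a1 + b1) / 2 <= b1 by split; lra.
  have [n1 n2] : c1 <= (c1 + d1) / 2 /\ (c1 + d1) / 2 <= d1 by split; lra.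
  case: asboolP => /= [P1|nP1']; last by split.
  case: asboolP => /= [P2|nP2']; last by split.
  case: asboolP => /= [P3|nP3']; last by split.
  by split=> // P4; apply: nP1; apply: split_P P1 P2 P3 P4.
have stepE k : [/\ (s k).1.1 <= (s k.+1).1.1, (s k.+1).1.2 <= (s k).1.2,
    (s k).2.1 <= (s k.+1).2.1 & (s k.+1).2.2 <= (s k).2.2] /\
    (s k.+1).1.2 - (s k.+1).1.1 = ((s k).1.2 - (s k).1.1) / 2 /\
    (s k.+1).2.2 - (s k.+1).2.1 = ((s k).2.2 - (s k).2.1) / 2.
  have := inv k; rewrite /s iterS -/(s k).
  case: (s k) => [[a1 b1] [c1 d1]] /= [ab1 cd1 _].
  by case: ifP => _ /=; [|case: ifP => _ /=; [|case: ifP => _ /=]];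
    (split; [split; lra|split; lra]).
have nest (lo hi : nat -> R) : (forall k, lo k <= hi k) ->
    (forall k, lo k <= lo k.+1) -> (forall k, hi k.+1 <= hi k) ->
    exists x, forall k, lo k <= x <= hi k.
  move=> lohi loS hiS; exists (sup (range lo)) => k.
  have lo_mono : {homo lo : i j / (i <= j)%N >-> i <= j}.
    by apply: homo_leq => // x y z; exact: le_trans.
  have hi_mono i j : (i <= j)%N -> hi j <= hi i.
    by elim: j => [|j IHj]; [rewrite leqn0 => /eqP->|
      rewrite leq_eqVlt => /predU1P[->//|/IHj]; exact: le_trans].
  have ub i j : lo i <= hi j.
    case: (leqP i j) => ij; first exact: le_trans (lo_mono _ _ ij) (lohi j).
    exact: le_trans (lohi i) (hi_mono _ _ (ltnW ij)).
  apply/andP; split.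
    apply: sup_upper_bound; last by exists k.
    by split; [exists (lo 0%N), 0%N|exists (hi 0%N) => _ [i _ <-]; exact: ub].
  by apply: ge_sup; [exists (lo 0%N), 0%N|move=> _ [i _ <-]; exact: ub].
have [x Hx] : exists x, forall k, (s k).1.1 <= x <= (s k).1.2.
  by apply: nest => k; [case: (inv k)|case: (stepE k) => -[]..].
have [y Hy] : exists y, forall k, (s k).2.1 <= y <= (s k).2.2.
  by apply: nest => k; [case: (inv k)|case: (stepE k) => -[]..].
have [dl dl0 H] := local_P _ _ (Hx 0%N) (Hy 0%N).
have width k : (s k).1.2 - (s k).1.1 = (b - a) / 2 ^+ k /\
               (s k).2.2 - (s k).2.1 = (d - c) / 2 ^+ k.
  elim: k => [|k [IH1 IH2]]; first by rewrite expr0 !divr1.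
  have [_ [-> ->]] := stepE k; rewrite IH1 IH2 exprSr invfM !mulrA; by split.
have ba0 : 0 <= b - a by rewrite subr_ge0.
have dc0 : 0 <= d - c by rewrite subr_ge0.
have [k [k1 k2]] : exists k, (b - a) / 2 ^+ k < dl /\ (d - c) / 2 ^+ k < dl.
  pose w := (b - a) + (d - c); have w0 : 0 <= w / dl.
    by apply: divr_ge0; [exact: addr_ge0|exact: ltW].
  (* Both sides have length at most [w], and [w / dl < k < 2 ^ k]. *)
  pose k := Num.Def.archi_bound (w / dl); exists k.
  have wk : w < dl * 2 ^+ k.
    rewrite mulrC -ltr_pdivrMr //; apply: lt_le_trans (archi_boundP w0) _.
    by rewrite -natrX ler_nat ltnW // ltn_expl.
  by split; rewrite ltr_pdivrMr ?exprn_gt0 //; apply: le_lt_trans wk;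
    rewrite /w ?lerDl ?lerDr.
have [_ _] := inv k; apply; apply: H => //.
- by have [-> _] := width k.
- by have [_ ->] := width k.
Qed.

(** The bound [eps * (width ^ 2 + height ^ 2)] is additive under quartering at the midpoints, so it
    passes from small rectangles to the given one. On small rectangles it holds because [g] is
    nearly affine there and affine functions integrate to 0. *)
Lemma goursat g a b c d : a <= b -> c <= d ->
  (forall z, in_rect a b c d z -> cdiff g z) -> rectint g a b c d = 0.
Proof.
move=> ab cd dg; pose S := (b - a) ^+ 2 + (d - c) ^+ 2.
have S0 : 0 <= S by rewrite addr_ge0 // sqr_ge0.
suff small (eps : R) : 0 < eps -> cnorm (rectint g a b c d) <= eps * S.
  apply: cnorm0_eq0; apply/eqP; rewrite eq_le cnorm_ge0 andbT.
  apply/ler_addgt0Pr => eps eps0; rewrite add0r.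
  have S1 : 0 < S + 1 by lra.
  apply: le_trans (small (eps / (S + 1)) _) _; first by rewrite divr_gt0.
  by rewrite mulrAC ler_pdivrMr // ler_pM2l //; lra.
move=> eps0.
(* Containment in the given rectangle is part of [P], so that [g] is differentiable wherever the
   bound is claimed. *)
pose P a' b' c' d' := a <= a' -> b' <= b -> c <= c' -> d' <= d ->
  cnorm (rectint g a' b' c' d') <= eps * ((b' - a') ^+ 2 + (d' - c') ^+ 2).
suff: P a b c d by apply.
apply: rect_bisection => //.
  move=> a1 b1 c1 d1 ab1 cd1 m n P1 P2 P3 P4 aa bb cc dd.
  have [m1 m2] : a1 <= m /\ m <= b1 by rewrite /m; split; lra.
  have [n1 n2] : c1 <= n /\ n <= d1 by rewrite /n; split; lra.
  have {}P1 := P1 aa (le_trans m2 bb) cc (le_trans n2 dd).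
  have {}P2 := P2 (le_trans aa m1) bb cc (le_trans n2 dd).
  have {}P3 := P3 aa (le_trans m2 bb) (le_trans cc n1) dd.
  have {}P4 := P4 (le_trans aa m1) bb (le_trans cc n1) dd.
  rewrite (@rectint_quarters g a1 b1 c1 d1 m n) ?m1 ?n1 //; last first.
    by move=> z Hz; apply/cdiff_ccont/dg; apply: in_rect_sub Hz.
  set r1 := rectint g a1 m c1 n in P1 *; set r2 := rectint g m b1 c1 n in P2 *.
  set r3 := rectint g a1 m n d1 in P3 *; set r4 := rectint g m b1 n d1 in P4 *.
  apply: le_trans (cnormD _ _) _.
  have := cnormD r1 r2; have := cnormD r3 r4.
  rewrite /m /n in P1 P2 P3 P4; lra.
move=> x y xab ycd.
have /dg/cdiff_affine[l Hl] : in_rect a b c d (x +i* y)%C by rewrite /in_rect /= xab.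
(* If [w] is the sum of the two side lengths, points of the rectangle are within [w] of [p] and the
   perimeter is [2 w]. The integral is at most [(eps / 4) w (2 w) = eps w ^ 2 / 2], and
   [w ^ 2 <= 2 (width ^ 2 + height ^ 2)]. Sides below [dl / 2] give [w < dl]. *)
have e4 : 0 < eps / 4 by rewrite divr_gt0.
have [dl dl0 H] := Hl _ e4.
exists (dl / 2) => [|a1 b1 c1 d1 xab1 ycd1 wb wd aa bb cc dd]; first by rewrite divr_gt0.
have ab1 : a1 <= b1 by lra.
have cd1 : c1 <= d1 by lra.
set p := (x +i* y)%C in l Hl H *.
pose h z := (g p - l * p) + l * z.
have ch z : ccont h z.
  apply: ccontD; first exact: ccont_cst.
  by apply: ccontM; [exact: ccont_cst|exact: ccont_id].
have cg : edge_cont g a1 b1 c1 d1.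
  by move=> z [Hz _]; apply/cdiff_ccont/dg; apply: in_rect_sub Hz.
have chN : edge_cont h a1 b1 c1 d1 by move=> z _; exact: ch.
have -> : rectint g a1 b1 c1 d1 = rectint (fun z => g z - h z) a1 b1 c1 d1.
  by rewrite rectintB // rectint_affine // subr0.
set w := (b1 - a1) + (d1 - c1).
have w0 : 0 <= w by rewrite /w; lra.
have hz z : in_rect a1 b1 c1 d1 z -> cnorm (z - p) <= w.
  move=> /andP[zx zy]; rewrite /cnorm ReD ImD ReN ImN /= /w.
  by apply: lerD; rewrite ler_norml; lra.
apply: (@le_trans _ _ (eps / 4 * w * (2 * (b1 - a1) + 2 * (d1 - c1)))).
  apply: cnorm_rectint => // [z Hz|z [Hz _]].
    apply: ccontD; first exact: cg.
    have := ccontM (ccont_cst (-1) z) (ch z); rewrite /ccont => H1 e e0.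
    by have [d0 d00 Hd] := H1 e e0; exists d0 => // q /Hd; rewrite !mulN1r.
  have -> : g z - h z = g z - (g p + l * (z - p)) by rewrite /h; ring.
  apply: le_trans (H _ _) _.
    by apply: le_lt_trans (hz _ Hz) _; rewrite /w; lra.
  by rewrite ler_wpM2l ?hz // divr_ge0 // ltW.
have -> : eps / 4 * w * (2 * (b1 - a1) + 2 * (d1 - c1)) = eps * (w ^+ 2 / 2).
  by rewrite /w; field.
rewrite ler_wpM2l ?(ltW eps0) // /w.
have := sqr_ge0 ((b1 - a1) - (d1 - c1)); lra.
Qed.

End RectangleIntegral.

(** * Cauchy's formula and bounds for iterated differences *)

Section CauchyFormula.
Variable R : realType.
Local Notation K := (R[i]).
Implicit Types (a b c d r : R) (f g F : K -> K) (z p q : K).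

Definition in_rect_int a b c d z :=
  (a < complex.Re z < b) && (c < complex.Im z < d).

(** The frame between the two rectangles is cut into two strips of full height and two blocks below
    and above the inner rectangle; [goursat] annihilates all four. *)
Lemma rectint_annulus g a b c d a' b' c' d' :
  a <= a' <= b' -> b' <= b -> c <= c' <= d' -> d' <= d ->
  (forall z, in_rect a b c d z -> ~~ in_rect_int a' b' c' d' z -> cdiff g z) ->
  rectint g a b c d = rectint g a' b' c' d'.
Proof.
move=> /andP[aa ab'] bb /andP[cc cd'] dd dg.
have ab : a' <= b by exact: le_trans ab' bb.
have cd : c' <= d by exact: le_trans cd' dd.
have hor k s t : (c <= k <= c') || (d' <= k <= d) -> a <= s -> t <= b ->
    ccont_on s t (fun t => g (t +i* k)%C).
  move=> Hk as' tb; apply: ccont_on_hor => u Hu; apply/cdiff_ccont/dg.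
    by rewrite /in_rect /=; move: Hk => /orP[] Hk; lra.
  by rewrite /in_rect_int /=; apply/negP => H; move: Hk => /orP[] Hk; lra.
have ver k s t : (a <= k <= a') || (b' <= k <= b) -> c <= s -> t <= d ->
    ccont_on s t (fun t => g (k +i* t)%C).
  move=> Hk as' tb; apply: ccont_on_ver => u Hu; apply/cdiff_ccont/dg.
    by rewrite /in_rect /=; move: Hk => /orP[] Hk; lra.
  by rewrite /in_rect_int /=; apply/negP => H; move: Hk => /orP[] Hk; lra.
rewrite (@rectint_splitv _ g a a' b c d) //; try (apply: hor; lra).
rewrite (@rectint_splitv _ g a' b' b c d) //; try (apply: hor; lra).
rewrite (@rectint_splith _ g a' b' c c' d) //; try (apply: ver; lra).
rewrite (@rectint_splith _ g a' b' c' d' d) //; try (apply: ver; lra).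
have out a1 b1 c1 d1 : a1 <= b1 -> c1 <= d1 -> a <= a1 -> b1 <= b -> c <= c1 ->
    d1 <= d -> [|| b1 <= a', b' <= a1, d1 <= c' | d' <= c1] ->
    rectint g a1 b1 c1 d1 = 0.
  move=> ab1 cd1 aa1 bb1 cc1 dd1 H; apply: goursat => // z Hz; apply: dg.
    exact: in_rect_sub Hz.
  apply/negP; move: Hz; rewrite /in_rect /in_rect_int => Hz Hz'.
  by move: H => /or4P[] H; lra.
have -> : rectint g a a' c d = 0 by apply: out => //; rewrite ?lexx ?orbT //; lra.
have -> : rectint g b' b c d = 0 by apply: out => //; rewrite ?lexx ?orbT //; lra.
have -> : rectint g a' b' c c' = 0 by apply: out => //; rewrite ?lexx ?orbT //; lra.
have -> : rectint g a' b' d' d = 0 by apply: out => //; rewrite ?lexx ?orbT //; lra.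
by rewrite !add0r !addr0.
Qed.

Lemma edge_neq p a b c d z : in_rect_int a b c d p -> rect_edge a b c d z -> z != p.
Proof.
move=> pin [_ Hz]; apply/eqP => zp; move: pin.
by rewrite /in_rect_int -{}zp => pin; case: Hz => Hz; lra.
Qed.

Lemma edge_cont_quot f p a b c d : in_rect_int a b c d p ->
  edge_cont f a b c d -> edge_cont (fun z => f z / (z - p)) a b c d.
Proof.
move=> pin cf z Hz; apply: ccontM; first exact: cf.
apply: ccontV; last exact: ccont_subr.
by rewrite subr_eq0; exact: edge_neq Hz.
Qed.

Lemma edge_cont_cst (k : K) a b c d : edge_cont (fun=> k) a b c d.
Proof. by move=> z _; exact: ccont_cst. Qed.

Lemma le_all_gt0 (x k : R) : 0 <= k -> (forall e, 0 < e -> e < 1 -> x <= k * e) ->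
  x <= 0.
Proof.
move=> k0 H; apply/ler_addgt0Pr => e e0; rewrite add0r.
pose e' := Num.min (e / (k + 1)) (1 / 2).
have k1 : 0 < k + 1 by lra.
have e'0 : 0 < e' by rewrite lt_min !divr_gt0.
have e'1 : e' < 1 by rewrite gt_min; apply/orP; right; lra.
apply: le_trans (H _ e'0 e'1) _.
apply: (@le_trans _ _ ((k + 1) * e')); first by rewrite ler_wpM2r ?(ltW e'0) //; lra.
by rewrite mulrC -ler_pdivlMr // ge_min lexx.
Qed.

(** The difference of the two sides is the integral of [(F z - F p) / (z - p)], which is bounded
    near [p]; [rectint_annulus] shrinks the contour to [p], so the integral is 0. The integral of
    [1 / (z - p)] stays as a factor in place of [2 pi i]. *)
Lemma cauchy_formula F a b c d p :
  (forall z, in_rect a b c d z -> cdiff F z) -> in_rect_int a b c d p ->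
  rectint (fun z => F z / (z - p)) a b c d =
  F p * rectint (fun z => 1 / (z - p)) a b c d.
Proof.
move=> dF pin; have [ab cd] : a <= b /\ c <= d.
  by move: pin => /andP[? ?]; split; lra.
have cF : edge_cont F a b c d by move=> z [Hz _]; exact/cdiff_ccont/dF.
have c1 := @edge_cont_cst 1 a b c d.
have cp := edge_cont_quot pin c1.
rewrite -rectintZ //; apply/subr0_eq; rewrite -rectintB //; first last.
- by move=> z Hz; apply: ccontM; [exact: ccont_cst|exact: cp].
- exact: edge_cont_quot.
pose g z := (F z - F p) / (z - p).
rewrite (@eq_rectint _ _ g) //; last first.
  by move=> z Hz; rewrite /g mulrBl mulrA mulr1.
have pin' : in_rect a b c d p.
  by move: pin; rewrite /in_rect /in_rect_int => ?; lra.
have [l Hl] := cdiff_affine (dF _ pin').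
have [dl dl0 H] := Hl _ ltr01.
pose x := complex.Re p; pose y := complex.Im p.
(* Squares about [p] of half-side [s <= w] lie in the rectangle, and their points are within
   [2 s <= dl / 2] of [p], where the affine approximation is valid. *)
pose w := Num.min (Num.min (x - a) (b - x)) (Num.min (Num.min (y - c) (d - y)) (dl / 4)).
have w0 : 0 < w.
  move: pin => /andP[/andP[p1 p2] /andP[p3 p4]].
  by rewrite !lt_min !subr_gt0 p1 p2 p3 p4 divr_gt0.
have [wa [wb [wc [wd wdl]]]] :
    w <= x - a /\ w <= b - x /\ w <= y - c /\ w <= d - y /\ w <= dl / 4.
  by rewrite /w !ge_min !lexx !orbT.
apply: cnorm0_eq0; apply/eqP; rewrite eq_le cnorm_ge0 andbT.
pose L := cnorm l + 1.
have L0 : 0 <= L by have := cnorm_ge0 l; rewrite /L; lra.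
apply: (@le_all_gt0 _ (L * 16 * w)); first by rewrite !mulr_ge0 // ltW.
move=> e e0 e1.
have ew0 : 0 < e * w by rewrite mulr_gt0.
have ew : e * w <= w by rewrite ler_piMl ?ltW.
set s := e * w in ew0 ew.
have Hx : in_rect_int (x - s) (x + s) (y - s) (y + s) p.
  by rewrite /in_rect_int -/x -/y; lra.
rewrite (@rectint_annulus g a b c d (x - s) (x + s) (y - s) (y + s)); try lra; last first.
  move=> z Hz Hz'; apply: cdiff_quot.
    by apply: contraNneq Hz' => ->.
  exact/cdiff_subr/dF.
(* The quotient is at most [L |z - p|] times [2 / |z - p|], that is [2 L], and the perimeter is
   [8 s]. *)
have -> : L * 16 * w * e = (2 * L) * (2 * (x + s - (x - s)) + 2 * (y + s - (y - s))).
  by rewrite /s; ring.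
apply: cnorm_rectint; [lra|lra| |].
  apply: edge_cont_quot => // z [Hz _].
  apply: ccontD; last exact: ccont_cst.
  by apply/cdiff_ccont/dF; apply: in_rect_sub Hz; lra.
move=> z Hz; have zp := edge_neq Hx Hz.
have n0 : 0 < cnorm (z - p) by apply: cnorm_gt0; rewrite subr_eq0.
have nz : cnorm (z - p) <= 2 * s.
  case: Hz => /andP[zx zy] _; rewrite /cnorm ReD ImD ReN ImN -/x -/y.
  rewrite mulr_natl mulr2n; apply: lerD; rewrite ler_norml; lra.
have Fz : cnorm (F z - F p) <= L * cnorm (z - p).
  have -> : F z - F p = (F z - (F p + l * (z - p))) + l * (z - p) by ring.
  apply: le_trans (cnormD _ _) _; rewrite /L mulrDl mul1r addrC lerD //.
    exact: cnormM.
  rewrite -[leRHS]mul1r; apply: H; apply: le_lt_trans nz _.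
  by have := dl0; lra.
rewrite /g; apply: le_trans (cnormM _ _) _.
apply: (@le_trans _ _ ((L * cnorm (z - p)) * (2 / cnorm (z - p)))).
  by apply: ler_pM; rewrite ?cnorm_ge0 ?cnormV.
by rewrite mulrACA mulfV ?gt_eqF // mulr1 mulrC.
Qed.

Lemma cnorm_far p z r : 0 < r ->
  (r <= `|complex.Re z - complex.Re p|) || (r <= `|complex.Im z - complex.Im p|) ->
  z - p != 0 /\ cnorm (z - p)^-1 <= 2 / r.
Proof.
move=> r0 H; have n0 : r <= cnorm (z - p).
  have := Re_le_cnorm (z - p); have := Im_le_cnorm (z - p).
  by rewrite ReD ReN ImD ImN; case/orP: H => H; lra.
have zp : 0 < cnorm (z - p) by exact: lt_le_trans r0 n0.
split; first by apply: contraTneq zp => ->; rewrite cnorm0 ltxx.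
apply: le_trans (cnormV _) _; rewrite ler_wpM2l // lef_pV2 ?posrE //.
Qed.

(* The difference is [(p - q) / ((z - p) (z - q))], whose integral does not change
   when the rectangle grows and tends to 0. *)
Lemma rectint_inv_indep a b c d p q :
  in_rect_int a b c d p -> in_rect_int a b c d q ->
  rectint (fun z => 1 / (z - p)) a b c d = rectint (fun z => 1 / (z - q)) a b c d.
Proof.
move=> pin qin; have [ab cd] : a <= b /\ c <= d.
  by move: pin => /andP[? ?]; split; lra.
have c1 := @edge_cont_cst 1 a b c d.
apply/subr0_eq; rewrite -rectintB //; try exact: edge_cont_quot.
pose h z := (p - q) / (z - p) / (z - q).
rewrite (@eq_rectint _ _ h) //; last first.
  move=> z Hz; rewrite /h.
  have zp : z - p != 0 by rewrite subr_eq0; exact: edge_neq Hz.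
  have zq : z - q != 0 by rewrite subr_eq0; exact: edge_neq Hz.
  by field; rewrite zp zq.
apply: cnorm0_eq0; apply/eqP; rewrite eq_le cnorm_ge0 andbT.
pose W := 2 * (b - a) + 2 * (d - c).
have W0 : 0 <= W by rewrite /W; lra.
apply: (@le_all_gt0 _ (cnorm (p - q) * 4 * (W + 8))).
  by rewrite !mulr_ge0 ?cnorm_ge0 //; lra.
(* On the rectangle enlarged by [r] the integrand is at most [4 |p - q| / r ^ 2] and the perimeter
   is [W + 8 r], so the integral is of order [1 / r = e]. *)
move=> e e0 e1; pose r := e^-1.
have r0 : 0 < r by rewrite invr_gt0.
have r1 : 1 <= r by rewrite /r invf_ge1 // ltW.
have offp z : ~~ in_rect_int a b c d z -> z != p by apply: contraNneq => ->.
have offq z : ~~ in_rect_int a b c d z -> z != q by apply: contraNneq => ->.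
rewrite -(@rectint_annulus h (a - r) (b + r) (c - r) (d + r) a b c d); try lra; last first.
  move=> z Hz Hz'; apply: cdiff_quot; first exact: offq.
  apply: cdiff_quot; [exact: offp|exact: cdiff_cst].
have pin2 : in_rect_int (a - r) (b + r) (c - r) (d + r) p.
  by move: pin; rewrite /in_rect_int => ?; lra.
have qin2 : in_rect_int (a - r) (b + r) (c - r) (d + r) q.
  by move: qin; rewrite /in_rect_int => ?; lra.
apply: (@le_trans _ _ (cnorm (p - q) * (2 / r) * (2 / r) *
    (2 * (b + r - (a - r)) + 2 * (d + r - (c - r))))).
  apply: cnorm_rectint; [lra|lra| |].
    by apply: edge_cont_quot => //; apply: edge_cont_quot => //; exact: edge_cont_cst.
  move=> z Hz.
  have far w : in_rect_int a b c d w -> cnorm (z - w)^-1 <= 2 / r.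
    move=> win; apply: (proj2 (cnorm_far r0 _)).
    move: win => /andP[/andP[w1 w2] /andP[w3 w4]]; case: Hz => _ Hz.
    by rewrite !ler_normr -orbA; apply/or4P; case: Hz => Hz;
      [constructor 2|constructor 1|constructor 4|constructor 3]; lra.
  rewrite /h; apply: le_trans (cnormM _ _) _; apply: ler_pM; rewrite ?cnorm_ge0 ?far //.
  apply: le_trans (cnormM _ _) _; apply: ler_pM; rewrite ?cnorm_ge0 ?far //.
have -> : 2 * (b + r - (a - r)) + 2 * (d + r - (c - r)) = W + 8 * r.
  by rewrite /W; ring.
have -> : cnorm (p - q) * 4 * (W + 8) * e =
    cnorm (p - q) * (2 / r) * (2 / r) * (r * (W + 8)).
  by rewrite /r; field; rewrite gt_eqF.
rewrite ler_wpM2l //.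
  have q0 : 0 <= 2 / r by rewrite divr_ge0 // ltW.
  by apply: mulr_ge0 => //; apply: mulr_ge0 => //; exact: cnorm_ge0.
by rewrite mulrDr [r * 8]mulrC lerD2r ler_peMl.
Qed.

(** Each side contributes to the imaginary part an integral of [r / (s ^ 2 + r ^ 2) >= 1 / (2 r)]
    over a length [2 r], hence at least 1; this bounds it away from 0 without evaluating an
    arctangent. *)
Lemma rectint_inv_neq0 (x y r : R) : 0 < r ->
  rectint (fun z => 1 / (z - (x +i* y)%C)) (x - r) (x + r) (y - r) (y + r) != 0.
Proof.
move=> r0; set p := (x +i* y)%C; pose g z := 1 / (z - p).
have xr : x - r <= x + r by lra.
have yr : y - r <= y + r by lra.
have pin : in_rect_int (x - r) (x + r) (y - r) (y + r) p.
  by rewrite /in_rect_int /=; lra.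
have cg : edge_cont g (x - r) (x + r) (y - r) (y + r).
  by apply: edge_cont_quot => //; exact: edge_cont_cst.
have [[h1r h1i] [h2r h2i] [v1r v1i] [v2r v2i]] := edge_cont_sides xr yr cg.
have ge1 (a b : R) (f : R -> R) : b - a = 2 * r -> cont_on a b f ->
    (forall t, a <= t <= b -> 1 / (2 * r) <= f t) -> 1 <= rint a b f.
  move=> ba cf Hf; have ab : a <= b by lra.
  have <- : rint a b (fun=> 1 / (2 * r)) = 1.
    by rewrite rint_cst // ba; field; rewrite gt_eqF.
  by apply: le_rint => // t _; exact: cvg_cst.
have val (s : R) : - r <= s <= r -> 1 / (2 * r) <= r / (s ^+ 2 + r ^+ 2).
  move=> sr; have q0 : 0 < s ^+ 2 + r ^+ 2 by rewrite ltr_wpDl ?sqr_ge0 ?exprn_gt0.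
  rewrite ler_pdivrMr ?mulr_gt0 // mulrAC ler_pdivlMr // mul1r; nra.
apply/eqP => /(congr1 (@complex.Im R)).
rewrite /rectint !(ImD, ImN, ImM, ReD, ReN) /= !mul0r !mul1r add0r => E.
have I1 : 1 <= rint (x - r) (x + r) (fun t => complex.Im (g (t +i* (y - r))%C)).
  apply: ge1 => // [|t Ht]; first by ring.
  have -> : complex.Im (g (t +i* (y - r))%C) = r / ((t - x) ^+ 2 + r ^+ 2).
    by rewrite /g div1r ImV ReD ImD ReN ImN /=; congr (_ / _); ring.
  by apply: val; lra.
have I2 : 1 <= rint (x - r) (x + r) (fun t => -1 * complex.Im (g (t +i* (y + r))%C)).
  apply: ge1 => [|//|t Ht]; first by ring.
    exact: cont_onZ.
  have -> : complex.Im (g (t +i* (y + r))%C) = - r / ((t - x) ^+ 2 + r ^+ 2).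
    by rewrite /g div1r ImV ReD ImD ReN ImN /=; congr (- _ / _); ring.
  by rewrite mulN1r mulNr opprK; apply: val; lra.
have I3 : 1 <= rint (y - r) (y + r) (fun t => complex.Re (g ((x + r) +i* t)%C)).
  apply: ge1 => // [|t Ht]; first by ring.
  have -> : complex.Re (g ((x + r) +i* t)%C) = r / ((t - y) ^+ 2 + r ^+ 2).
    by rewrite /g div1r ReV ReD ImD ReN ImN /=; congr (_ / _); ring.
  by apply: val; lra.
have I4 : 1 <= rint (y - r) (y + r) (fun t => -1 * complex.Re (g ((x - r) +i* t)%C)).
  apply: ge1 => [|//|t Ht]; first by ring.
    exact: cont_onZ.
  have -> : complex.Re (g ((x - r) +i* t)%C) = - r / ((t - y) ^+ 2 + r ^+ 2).
    by rewrite /g div1r ReV ReD ImD ReN ImN /=; congr (_ / _); ring.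
  by rewrite mulN1r mulNr opprK; apply: val; lra.
move: I2 I4; rewrite !rintZ // => I2 I4.
by rewrite -/g in E; lra.
Qed.

End CauchyFormula.

(** * Extrapolation along an arithmetic progression *)

Section Differences.
Variable R : realType.
Local Notation K := (R[i]).
Implicit Types (F : K -> K) (z c d : K).

(** This is [(1 - T) ^ j F] for the shift [T] by [d]; the sign, opposite to that of the usual
    forward difference, makes [1 - T] complementary to [T]. *)
Fixpoint dif d (j : nat) F z : K :=
  if j is j'.+1 then dif d j' F z - dif d j' F (z + d) else F z.

Lemma dif_shift d j F z : dif d j (fun w => F (w + d)) z = dif d j F (z + d).
Proof. by elim: j z => //= j IHj z; rewrite !IHj. Qed.

Lemma difS d j F z : dif d j.+1 F z = dif d j (fun w => F w - F (w + d)) z.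
Proof. by elim: j z => //= j IHj z; rewrite -!IHj. Qed.

Lemma dif_sum d j F z :
  dif d j F z = \sum_(0 <= i < j.+1) (-1) ^+ i * ('C(j, i))%:R * F (z + d *+ i).
Proof.
elim: j z => [|j IHj] z /=.
  by rewrite big_nat1 expr0 bin0 !mul1r mulr0n addr0.
rewrite !IHj [X in X - _ = _]big_nat_recl // [in RHS]big_nat_recl // !bin0.
rewrite -!addrA; congr (_ + _).
have -> : \sum_(0 <= i < j.+1) (-1) ^+ i.+1 * ('C(j.+1, i.+1))%:R *
      F (z + d *+ i.+1) =
    \sum_(0 <= i < j.+1) (-1) ^+ i.+1 * ('C(j, i.+1))%:R * F (z + d *+ i.+1) +
    \sum_(0 <= i < j.+1) (-1) ^+ i.+1 * ('C(j, i))%:R * F (z + d *+ i.+1).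
  rewrite -big_split /=; apply: eq_bigr => i _.
  by rewrite binS natrD mulrDr mulrDl.
congr (_ + _).
  by rewrite [in RHS]big_nat_recr //= bin_small // mulr0 mul0r addr0.
rewrite -sumrN; apply: eq_bigr => i _.
by rewrite -addrA -mulrS exprS mulN1r !mulNr.
Qed.

(* [1 = (T + (1 - T)) ^ N] for the shift operator [T]. *)
Lemma dif_binomial d N F z :
  \sum_(0 <= k < N.+1) ('C(N, k))%:R * dif d (N - k) F (z + d *+ k) = F z.
Proof.
elim: N F => [|N IHN] F; first by rewrite big_nat1 bin0 mul1r mulr0n addr0.
rewrite -[RHS](subrK (F (z + d))).
rewrite -(IHN (fun w => F w - F (w + d))) -(IHN (fun w => F (w + d))).
rewrite big_nat_recl // subn0 bin0.
have -> : \sum_(0 <= i < N.+1) ('C(N.+1, i.+1))%:R *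
      dif d (N.+1 - i.+1) F (z + d *+ i.+1) =
    \sum_(0 <= i < N.+1) ('C(N, i.+1))%:R * dif d (N - i) F (z + d *+ i.+1) +
    \sum_(0 <= i < N.+1) ('C(N, i))%:R * dif d (N - i) F (z + d *+ i.+1).
  rewrite -big_split /=; apply: eq_bigr => i _.
  by rewrite subSS binS natrD mulrDl.
rewrite addrA; congr (_ + _); last first.
  by apply: eq_bigr => i _; rewrite dif_shift -addrA -mulrSr.
rewrite [in RHS]big_nat_recl // subn0 bin0 difS; congr (_ + _).
rewrite big_nat_recr //= bin_small // mul0r addr0.
apply: eq_big_nat => i /andP[_ iN]; rewrite -difS.
by rewrite subnSK.
Qed.

(** Up to the factor [(-1) ^ j j! d ^ j], the [j]-th difference in [c] of the Cauchy kernel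
    [1 / (z - c)]. *)
Definition dif_kernel d (j : nat) c z : K :=
  \prod_(0 <= i < j.+1) (z - (c + d *+ i))^-1.

Lemma dif_kernelS d j c z : (forall i, (i <= j.+1)%N -> z != c + d *+ i) ->
  dif_kernel d j c z - dif_kernel d j (c + d) z =
  - (j.+1%:R * d) * dif_kernel d j.+1 c z.
Proof.
move=> zc; rewrite /dif_kernel.
have z0 : z - c != 0 by have := zc 0%N isT; rewrite mulr0n addr0 subr_eq0.
have zj : z - (c + d *+ j.+1) != 0 by rewrite subr_eq0 zc.
rewrite [in RHS]big_nat_recr //= (big_nat_recl _ _ _ (leq0n j)).
rewrite mulr0n addr0 [X in _ - X]big_nat_recr //=.
rewrite (eq_bigr (fun i => (z - (c + d + d *+ i))^-1)); last first.
  by move=> i _; rewrite mulrS addrA.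
set A := \prod_(_ <= _ < _) _.
have -> : c + d + d *+ j = c + d *+ j.+1 by rewrite mulrS addrA.
rewrite mulr_natl; move: (d *+ j.+1) zj => e ze.
by field; rewrite z0 ze.
Qed.

Lemma cnormX z j : cnorm (z ^+ j) <= cnorm z ^+ j.
Proof.
elim: j => [|j IHj]; first by rewrite !expr0 /cnorm /= normr1 normr0 addr0.
rewrite !exprS; apply: le_trans (cnormM _ _) _.
by rewrite ler_wpM2l // cnorm_ge0.
Qed.

Lemma cnorm_nat j : cnorm (j%:R : K) <= j%:R.
Proof.
elim: j => [|j IHj]; first by rewrite cnorm0.
rewrite -!natr1; apply: le_trans (cnormD _ _) _; rewrite lerD //.
by rewrite /cnorm /= normr1 normr0 addr0.
Qed.

Lemma cnorm_prod (I : Type) (r : seq I) (P : pred I) (f : I -> K) (M : R) :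
  (forall i, P i -> cnorm (f i) <= M) ->
  cnorm (\prod_(i <- r | P i) f i) <= \prod_(i <- r | P i) M.
Proof.
move=> fM; elim/big_rec2: _ => [|i y1 y2 Pi IH].
  by rewrite /cnorm /= normr1 normr0 addr0.
apply: le_trans (cnormM _ _) _; apply: ler_pM; rewrite ?cnorm_ge0 //; exact: fM.
Qed.

Section Square.
Variables (F : K -> K) (x y r M : R).
Hypothesis r0 : 0 < r.

Let sq := in_rect (x - r) (x + r) (y - r) (y + r).
Let core z := (`|complex.Re z - x| <= r / 2) && (`|complex.Im z - y| <= r / 2).
Let kappa := rectint (fun z => 1 / (z - (x +i* y)%C)) (x - r) (x + r) (y - r) (y + r).

Hypothesis F_diff : forall z, sq z -> cdiff F z.
Hypothesis F_bound : forall z, sq z -> cnorm (F z) <= M.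

Let xr : x - r <= x + r. Proof. by have := r0; lra. Qed.
Let yr : y - r <= y + r. Proof. by have := r0; lra. Qed.

Let core_int z : core z -> in_rect_int (x - r) (x + r) (y - r) (y + r) z.
Proof.
by rewrite /core /in_rect_int !ler_norml => /andP[? ?]; have := r0; lra.
Qed.

Let edge_core c z : core c -> rect_edge (x - r) (x + r) (y - r) (y + r) z ->
  z != c /\ cnorm (z - c)^-1 <= 4 / r.
Proof.
move=> cc [_ Hz]; have r20 : 0 < r / 2 by rewrite divr_gt0.
have [zc nz] : z - c != 0 /\ cnorm (z - c)^-1 <= 2 / (r / 2).
  apply: (cnorm_far r20); move: cc; rewrite /core !ler_norml => /andP[? ?].
  by rewrite !ler_normr -orbA; apply/or4P; case: Hz => Hz;
    [constructor 2|constructor 1|constructor 4|constructor 3]; lra.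
split; first by rewrite -subr_eq0.
by rewrite (_ : 4 / r = 2 / (r / 2)) //; field; rewrite gt_eqF.
Qed.

Let kernel_cont d j c : (forall i, (i <= j)%N -> core (c + d *+ i)) ->
  edge_cont (fun z => F z * dif_kernel d j c z) (x - r) (x + r) (y - r) (y + r).
Proof.
move=> cc z Hz; apply: ccontM; first by case: Hz => Hz _; exact/cdiff_ccont/F_diff.
elim: j cc => [|j IHj] cc.
  have -> : dif_kernel d 0 c = (fun z => (z - (c + d *+ 0))^-1).
    by apply/funext => w; rewrite /dif_kernel big_nat1.
  apply: ccontV; last exact: ccont_subr.
  by rewrite subr_eq0; case: (edge_core (cc 0%N isT) Hz).
have -> : dif_kernel d j.+1 c =
    (fun z => dif_kernel d j c z * (z - (c + d *+ j.+1))^-1).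
  by apply/funext => w; rewrite /dif_kernel big_nat_recr.
apply: ccontM; first by apply: IHj => i ij; apply: cc; rewrite leqW.
apply: ccontV; last exact: ccont_subr.
by rewrite subr_eq0; case: (edge_core (cc j.+1 (leqnn _)) Hz).
Qed.

(** Taking differences in Cauchy's formula acts on the kernel alone, since by [rectint_inv_indep]
    the factor [kappa] is common to all nodes. *)
Let dif_cauchy d j c : (forall i, (i <= j)%N -> core (c + d *+ i)) ->
  kappa * dif d j F c = (-1) ^+ j * (j`!)%:R * d ^+ j *
    rectint (fun z => F z * dif_kernel d j c z) (x - r) (x + r) (y - r) (y + r).
Proof.
elim: j c => [|j IHj] c cc.
  have c0 : core c by have := cc 0%N isT; rewrite mulr0n addr0.
  rewrite /= !mul1r (@eq_rectint _ _ (fun z => F z / (z - c))) //; last first.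
    by move=> z _; rewrite /dif_kernel big_nat1 mulr0n addr0.
  rewrite cauchy_formula ?core_int // mulrC; congr (_ * _).
  apply: rectint_inv_indep; last exact: core_int.
  by rewrite /in_rect_int /=; have := r0; lra.
have cc1 i : (i <= j)%N -> core (c + d *+ i) by move=> ij; apply: cc; rewrite leqW.
have cc2 i : (i <= j)%N -> core (c + d + d *+ i).
  by move=> ij; rewrite -addrA -mulrS; exact: cc.
rewrite /= mulrBr IHj // IHj // -mulrBr -rectintB //; try exact: kernel_cont.
rewrite (@eq_rectint _ _ (fun z => - (j.+1%:R * d) * (F z * dif_kernel d j.+1 c z))) //.
  rewrite rectintZ //; last exact: kernel_cont.
  by rewrite factS natrM !exprS; ring.
move=> z Hz; rewrite -mulrBr dif_kernelS; first by rewrite mulrCA.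
by move=> i ij; case: (edge_core (cc i ij) Hz).
Qed.

(** Nodes in the half-size square are at least [r / 2] away from the edges, so each of the [j + 1]
    kernel factors is at most [4 / r]; with the perimeter [8 r] this leaves [32 (4 / r) ^ j]. It
    matters that [B] depends neither on [j] nor on [d]. *)
Lemma dif_bound : exists2 B : R, 0 <= B & forall d j c,
  (forall i, (i <= j)%N -> core (c + d *+ i)) ->
  cnorm (dif d j F c) <= B * (j`!)%:R * (4 * cnorm d / r) ^+ j.
Proof.
have k0 : kappa != 0 by exact: rectint_inv_neq0.
have M0 : 0 <= M.
  apply: le_trans (cnorm_ge0 (F (x +i* y)%C)) _; apply: F_bound.
  by rewrite /sq /in_rect /=; have := r0; lra.
exists (cnorm kappa^-1 * (M * 32)).
  by rewrite !mulr_ge0 ?cnorm_ge0.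
move=> d j c cc.
have -> : dif d j F c = kappa^-1 * ((-1) ^+ j * (j`!)%:R * d ^+ j *
    rectint (fun z => F z * dif_kernel d j c z) (x - r) (x + r) (y - r) (y + r)).
  by rewrite -dif_cauchy // mulKf.
apply: le_trans (cnormM _ _) _; rewrite -!mulrA.
rewrite ler_wpM2l ?cnorm_ge0 //.
rewrite !mulrA; apply: le_trans (cnormM _ _) _.
have S : cnorm ((-1) ^+ j * (j`!)%:R * d ^+ j) <= (j`!)%:R * cnorm d ^+ j.
  apply: le_trans (cnormM _ _) _; apply: ler_pM; rewrite ?cnorm_ge0 ?cnormX //.
  apply: le_trans (cnormM _ _) _; rewrite -[leRHS]mul1r.
  apply: ler_pM; rewrite ?cnorm_ge0 ?cnorm_nat //.
  apply: le_trans (cnormX _ _) _.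
  by rewrite cnormN /cnorm /= normr1 normr0 addr0 expr1n.
have I : cnorm (rectint (fun z => F z * dif_kernel d j c z)
    (x - r) (x + r) (y - r) (y + r)) <= M * (4 / r) ^+ j.+1 * (8 * r).
  have -> : 8 * r = 2 * (x + r - (x - r)) + 2 * (y + r - (y - r)) by ring.
  apply: cnorm_rectint => //; first exact: kernel_cont.
  move=> z Hz; apply: le_trans (cnormM _ _) _.
  apply: ler_pM; rewrite ?cnorm_ge0 //; first by case: Hz => Hz _; exact: F_bound.
  rewrite /dif_kernel big_nat_cond.
  apply: le_trans (cnorm_prod (M := 4 / r) _ _) _.
    by move=> i /andP[/andP[_ ij] _]; case: (edge_core (cc i ij) Hz).
  by rewrite -big_nat_cond big_const_nat subn0 iter_mulr_1.
apply: le_trans (ler_pM (cnorm_ge0 _) (cnorm_ge0 _) S I) _.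
rewrite le_eqVlt; apply/orP; left; apply/eqP.
have -> : 4 * cnorm d / r = cnorm d * (4 / r) by rewrite mulrAC mulrC.
rewrite [(4 / r) ^+ j.+1]exprS [(cnorm d * _) ^+ j]exprMn.
set Q := (4 / r) ^+ j; set D := cnorm d ^+ j.
by field; rewrite gt_eqF.
Qed.

End Square.

(** The product is a falling factorial; the inequality absorbs the factorial of [dif_bound]. *)
Lemma bin_fact_le (N j : nat) : ('C(N, j) * j`! <= N ^ j)%N.
Proof.
rewrite bin_ffact; elim: j N => [|j IHj] N; first by rewrite ffactn0.
case: N => [|N]; first by rewrite ffact0n.
rewrite ffactnS expnS leq_mul2l /=; apply: leq_trans (IHj _) _.
by case: j {IHj} => // j; rewrite leq_exp2r.
Qed.

Lemma cnorm_sum (I : Type) (s : seq I) (P : pred I) (f : I -> K) :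
  cnorm (\sum_(i <- s | P i) f i) <= \sum_(i <- s | P i) cnorm (f i).
Proof.
elim/big_rec2: _ => [|i y1 y2 _ IH]; first by rewrite cnorm0.
by apply: le_trans (cnormD _ _) _; rewrite lerD2l.
Qed.

Lemma sum_half_pow (m : nat) :
  \sum_(0 <= k < m) (2^-1 : R) ^+ (m - k) = 1 - 2^-1 ^+ m.
Proof.
elim: m => [|m IHm]; first by rewrite big_nil expr0 subrr.
rewrite big_nat_recl // subn0.
under eq_bigr do rewrite subSS.
by rewrite IHm !exprS; field.
Qed.

(** The terms [k >= m] of [dif_binomial] for [N = m + n], with the differences expanded by
    [dif_sum]; only values at [z + l d] with [m <= l <= m + n] enter. *)
Definition extrapolation F d (m n : nat) z : K :=
  \sum_(m <= k < (m + n).+1) \sum_(0 <= i < (m + n - k).+1)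
    ('C(m + n, k))%:R * ((-1) ^+ i * ('C(m + n - k, i))%:R) * F (z + d *+ (k + i)).

(** A dropped term has order [j = m + n - k > n] and is at most [B ((m + n) q) ^ j <= B 2 ^ - j], by
    [dif_bound] and [bin_fact_le]; the geometric sum over [j > n] stays below [B 2 ^ - n]. *)
Lemma extrapolation_error F (x y r M : R) : 0 < r ->
  (forall z, in_rect (x - r) (x + r) (y - r) (y + r) z -> cdiff F z) ->
  (forall z, in_rect (x - r) (x + r) (y - r) (y + r) z -> cnorm (F z) <= M) ->
  exists2 B : R, 0 <= B & forall d (m n : nat) z,
    (forall i, (i <= m + n)%N -> (`|complex.Re (z + d *+ i) - x| <= r / 2) &&
                                 (`|complex.Im (z + d *+ i) - y| <= r / 2)) ->
    (m + n)%:R * (4 * cnorm d / r) <= 2^-1 ->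
    cnorm (F z - extrapolation F d m n z) <= B * 2^-1 ^+ n.
Proof.
move=> r0 F_diff F_bound; have [B B0 HB] := dif_bound r0 F_diff F_bound.
exists B => // d m n z zin; set q := 4 * cnorm d / r => Nq.
have q0 : 0 <= q by rewrite divr_ge0 ?mulr_ge0 ?cnorm_ge0 ?(ltW r0).
have -> : F z - extrapolation F d m n z =
    \sum_(0 <= k < m) ('C(m + n, k))%:R * dif d (m + n - k) F (z + d *+ k).
  rewrite -{1}(dif_binomial d (m + n) F z).
  rewrite (@big_cat_nat _ _ _ m) //=; last by rewrite leqW // leq_addr.
  rewrite -addrA -[RHS]addr0; congr (_ + _); apply/eqP; rewrite subr_eq0; apply/eqP.
  apply: eq_bigr => k _; rewrite dif_sum mulr_sumr; apply: eq_bigr => i _.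
  by rewrite !mulrA -addrA -mulrnDr.
apply: le_trans (cnorm_sum _ _ _) _.
apply: (@le_trans _ _ (\sum_(0 <= k < m) B * (2^-1 ^+ n * 2^-1 ^+ (m - k)))).
  apply: ler_sum_nat => k /andP[_ km].
  have kN : (k <= m + n)%N by rewrite ltnW // ltn_addr.
  apply: le_trans (cnormM _ _) _.
  have dk : cnorm (dif d (m + n - k) F (z + d *+ k)) <=
      B * ((m + n - k)`!)%:R * q ^+ (m + n - k).
    by apply: HB => i ik; rewrite -addrA -mulrnDr; apply: zin; lia.
  apply: le_trans (ler_pM (cnorm_ge0 _) (cnorm_ge0 _) (cnorm_nat _) dk) _.
  have -> : 2^-1 ^+ n * 2^-1 ^+ (m - k) = 2^-1 ^+ (m + n - k) :> R.
    by rewrite -exprD; congr (_ ^+ _); lia.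
  rewrite -(mulrA B) mulrCA ler_wpM2l //.
  apply: (@le_trans _ _ (((m + n)%:R * q) ^+ (m + n - k))); last first.
    apply: lerXn2r Nq; rewrite nnegrE; first exact: mulr_ge0.
    by rewrite invr_ge0.
  rewrite [((m + n)%:R * q) ^+ _]exprMn mulrA ler_wpM2r ?exprn_ge0 // -natrM -natrX ler_nat.
  by rewrite -bin_sub // bin_fact_le.
rewrite -mulr_sumr ler_wpM2l // -mulr_sumr sum_half_pow.
by rewrite ler_piMr ?exprn_ge0 // gerBl exprn_ge0.
Qed.

End Differences.

(** * Approximation on integer grids *)

Section GridApproximation.
Variables (R : realType) (C : function_class) (hC : good_class C).
Arguments C : clear implicits.
Local Notation K := (R[i]).

(** Membership phrased as closure under substitution lets the algorithms below be written as
    ordinary curried functions. *)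
Definition closed1 (d : nat -> nat) := forall n (a : n.-tuple nat -> nat),
  C n a -> C n (fun x => d (a x)).

Definition closed6 (G : nat -> nat -> nat -> nat -> nat -> nat -> nat) :=
  forall n (a1 a2 a3 a4 a5 a6 : n.-tuple nat -> nat),
  C n a1 -> C n a2 -> C n a3 -> C n a4 -> C n a5 -> C n a6 ->
  C n (fun x => G (a1 x) (a2 x) (a3 x) (a4 x) (a5 x) (a6 x)).

Definition part (j : bool) (z : K) : R := if j then complex.Re z else complex.Im z.

Definition grid_value (x0 x1 H : nat) : R := (x0%:R - x1%:R) / H%:R.

(* Input and output are integers, written as differences of naturals, over the
   denominators [H] and [e]: unlike reduced fractions these can be manipulated
   without gcds. *)
Definition grid_approx (F : K -> K) (A : set K) : Prop :=
  exists (d : nat -> nat)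
    (G : bool -> bool -> nat -> nat -> nat -> nat -> nat -> nat -> nat),
  [/\ closed1 d, forall j s, closed6 (G j s), forall e, (0 < e)%N -> (0 < d e)%N &
    forall (e H x0 x1 y0 y1 : nat) (z : K), (0 < e)%N -> (d e <= H)%N -> A z ->
      `|complex.Re z - grid_value x0 x1 H| <= (d e)%:R^-1 ->
      `|complex.Im z - grid_value y0 y1 H| <= (d e)%:R^-1 ->
      forall j, `|part j (F z) - grid_value (G j true x0 x1 y0 y1 H e)
                                            (G j false x0 x1 y0 y1 H e) e|
                <= 2 / e%:R].

Lemma grid_approx_sub (F : K -> K) (A B : set K) :
  B `<=` A -> grid_approx F A -> grid_approx F B.
Proof.
move=> BA [d [G [cd cG d0 H]]]; exists d, G; split=> //.
by move=> e h x0 x1 y0 y1 z e0 dh /BA; exact: H.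
Qed.

Lemma grid_approx_set0 (F : K -> K) : grid_approx F set0.
Proof.
exists (fun=> 1%N), (fun _ _ _ _ _ _ _ _ => 0%N); split=> //.
- by move=> n a _; exact: in_class_cst.
- by move=> j s n a1 a2 a3 a4 a5 a6 *; exact: in_class_cst.
Qed.

Lemma in_class_comp7 (g : 7.-tuple nat -> nat) n
    (a1 a2 a3 a4 a5 a6 a7 : n.-tuple nat -> nat) : C 7%N g ->
  C n a1 -> C n a2 -> C n a3 -> C n a4 -> C n a5 -> C n a6 -> C n a7 ->
  C n (fun x => g [tuple a1 x; a2 x; a3 x; a4 x; a5 x; a6 x; a7 x]).
Proof.
move=> Cg c1 c2 c3 c4 c5 c6 c7.
pose h (i : 'I_7) x := tnth [tuple a1 x; a2 x; a3 x; a4 x; a5 x; a6 x; a7 x] i.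
have Ch i : C n (h i) by case: i => [[|[|[|[|[|[|[|//]]]]]]]] ?.
apply: (in_class_eq (good_comp hC Cg Ch)) => x; congr g.
by apply: eq_from_tnth => i; rewrite tnth_mktuple.
Qed.

Lemma arg_code2 (a : 'rV[rat]_2) (e : nat) :
  arg_code a e = [tuple tnth (rat_code (a 0 0)) 0; tnth (rat_code (a 0 0)) 1;
    tnth (rat_code (a 0 0)) 2; tnth (rat_code (a 0 1)) 0; tnth (rat_code (a 0 1)) 1;
    tnth (rat_code (a 0 1)) 2; e].
Proof.
apply: val_inj; rewrite /= /ord_tuple /= !enum_ordSl !enum_ord0 /=.
have -> : lift ord0 ord0 = 1 :> 'I_2 by apply: val_inj.
by do ?congr (_ :: _); congr (tnth _ _); apply: val_inj.
Qed.

(* Congruent to 1 modulo [H], the numerator is coprime to the denominator. *)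
Definition reduced_frac (H x0 x1 : nat) : rat :=
  ((H * x0).+1%:Z - (H * x1)%:Z)%:~R / (H%:Z ^+ 2)%:~R.

Lemma rat_code_frac (H x0 x1 : nat) : (0 < H)%N ->
  rat_code (reduced_frac H x0 x1) =
  [tuple ((H * x0).+1 - H * x1)%N; (H * x1 - (H * x0).+1)%N; (H ^ 2)%N].
Proof.
rewrite /reduced_frac; move=> H0; set n := (_ - _)%R.
have cop : coprime `|n| `|(H%:Z ^+ 2)%R|.
  rewrite -coprimezE; apply: coprimezXr; rewrite coprimez_sym /coprimez.
  have -> : n = (x0%:Z - x1%:Z) * H%:Z + 1 by rewrite /n; lia.
  by rewrite gcdzMDl gcdz1.
have H2 : (H%:Z ^+ 2 : int) != 0 by rewrite expf_neq0 // -lt0n.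
rewrite /rat_code coprimeq_num // coprimeq_den // (negPf H2).
rewrite gtr0_sg ?exprn_gt0 ?ltz_nat // mul1r.
apply: val_inj => /=; congr [:: _; _; _]; rewrite /n; lia.
Qed.

Lemma ratr_frac (H x0 x1 : nat) : (0 < H)%N ->
  ratr (reduced_frac H x0 x1) = grid_value x0 x1 H + (H%:R ^+ 2)^-1.
Proof.
move=> H0; rewrite /reduced_frac rmorphM fmorphV /= !ratr_int /grid_value.
rewrite rmorphB rmorphXn /= -!pmulrn -natr1 !natrM.
by field; rewrite pnatr_eq0 -lt0n.
Qed.

Lemma ratr_code (q : rat) : exists p n d : nat,
  [/\ rat_code q = [tuple p; n; d], (0 < d)%N &
      ratr q = (p%:R - n%:R) / d%:R :> R].
Proof.
exists (absz (Num.max (numq q) 0)), (absz (Num.min 0 (numq q))), (absz (denq q)).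
split=> //; first by rewrite absz_gt0 denq_neq0.
have -> : `|denq q|%N%:R = (denq q)%:~R :> R.
  by rewrite natr_absz gtr0_norm ?denq_gt0.
rewrite /ratr; congr (_ / _); rewrite !pmulrn -intrB.
by congr (_%:~R); lia.
Qed.

Lemma row2_ge (x : 'rV[R]_2) i : `|x 0 i| <= `|x|.
Proof.
rewrite {2}/Num.norm /= mx_normrE.
exact: (@le_bigmax _ _ _ _ (fun k => `|x k.1 k.2|) (0, i)).
Qed.

Lemma row2_lt (x : 'rV[R]_2) (e : R) : 0 < e ->
  `|x 0 0| < e -> `|x 0 1| < e -> `|x| < e.
Proof.
move=> e0 x0 x1; rewrite /Num.norm /= mx_normrE; apply/bigmax_ltP; split=> //.
case=> i j _ /=; rewrite (ord1 i).
case: j => [[|[|//]]] ltj.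
  by rewrite (_ : Ordinal ltj = 0) //; apply: val_inj.
by rewrite (_ : Ordinal ltj = 1) //; apply: val_inj.
Qed.

Lemma floor_div (p d : nat) : (0 < d)%N ->
  0 <= p%:R / d%:R - (p %/ d)%N%:R :> R /\ p%:R / d%:R - (p %/ d)%N%:R < 1 :> R.
Proof.
move=> d0; have d0' : 0 < d%:R :> R by rewrite ltr0n.
have -> : p%:R / d%:R - (p %/ d)%N%:R = (p %% d)%N%:R / d%:R :> R.
  rewrite {1}(divn_eq p d) natrD natrM mulrDl mulfK ?gt_eqF //.
  by rewrite addrAC subrr add0r.
by rewrite divr_ge0 // ltr_pdivrMr // mul1r ltr_nat ltn_mod.
Qed.

(** Both truncation errors lie in [[0, 1)] and are subtracted from each other, so the total stays
    within one grid step rather than two. *)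
Lemma floor_scaled (p n d H : nat) : (0 < d)%N -> (0 < H)%N ->
  `|(p%:R - n%:R) / d%:R - grid_value (p * H %/ d) (n * H %/ d) H| <= H%:R^-1 :> R.
Proof.
move=> d0 H0; have H0' : 0 < H%:R :> R by rewrite ltr0n.
have [p1 p2] := floor_div (p * H) d0; have [n1 n2] := floor_div (n * H) d0.
have d0' : 0 < d%:R :> R by rewrite ltr0n.
rewrite /grid_value -(ler_pM2r H0') mulVf ?gt_eqF // -{2}(gtr0_norm H0') -normrM.
rewrite mulrBl divfK ?gt_eqF //.
move: p1 p2 n1 n2; rewrite !natrM.
set P := (_ %/ _)%N%:R; set N := (_ %/ _)%N%:R => p1 p2 n1 n2.
have -> : (p%:R - n%:R) / d%:R * H%:R - (P - N) =
    (p%:R * H%:R / d%:R - P) - (n%:R * H%:R / d%:R - N).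
  by field; rewrite gt_eqF.
by rewrite ler_norml; lra.
Qed.

End GridApproximation.

(** * Passing between coded rationals and integer grids *)

Section Conversions.
Variables (R : realType) (C : function_class) (hC : good_class C).
Arguments C : clear implicits.
Local Notation K := (R[i]).

Definition box (p : K) (r : R) : set K :=
  [set z | `|complex.Re z - complex.Re p| <= r /\
           `|complex.Im z - complex.Im p| <= r].

Definition coord (j : bool) : 'I_2 := if j then 0 else 1.

Lemma plane_of_complexE (z : K) j : plane_of_complex z 0 (coord j) = part j z.
Proof. by rewrite mxE; case: j. Qed.

Lemma plane_of_complexK (y : 'rV[R]_2) : plane_of_complex (y 0 0 +i* y 0 1)%C = y.
Proof.
apply/rowP => i; rewrite mxE; case: i => [[|[|//]]] lti /=.
  by congr (y _ _); apply: val_inj.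
by congr (y _ _); apply: val_inj.
Qed.

Lemma plane_fun_plane (F : R[i]^o -> R[i]^o) (z : K) :
  plane_fun F (plane_of_complex z) = plane_of_complex (F z).
Proof.
rewrite /plane_fun; congr (plane_of_complex (F _)).
have := plane_of_complexE z true; have := plane_of_complexE z false.
by rewrite /coord /= => -> ->; case: z.
Qed.

Lemma closed1_of_nat_fun (d : nat -> nat) : nat_fun_in C d -> closed1 C d.
Proof.
move=> Cd n a Ca.
apply: (in_class_eq (good_comp (g := fun _ : 'I_1 => a) hC Cd (fun=> Ca))) => x.
by rewrite tnth_mktuple.
Qed.

Lemma grid_approx_of_open (F : R[i]^o -> R[i]^o) (U : set R[i]^o) (u : K) (rho : R) :
  0 < rho -> (forall z : K, box u (2 * rho) z -> U z) ->
  in_class_on_open C (plane_set U) (plane_fun F) ->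
  grid_approx C F (box u rho).
Proof.
move=> rho0 uU [d0 [f [Cd0 Cf d00 Hf]]].
have cd0 := closed1_of_nat_fun Cd0.
have /choice[g Hg] : forall jk : bool * 'I_3, exists g : 7.-tuple nat -> nat,
    C 7%N g /\ forall (a : 'rV[rat]_2) e, g (arg_code a e) =
      tnth (rat_code (f a e 0 (coord jk.1))) jk.2.
  by move=> [j k]; have [g Cg Eg] := Cf (coord j) k; exists g.
(* Once [E] exceeds [bd], the smaller box lies in the [E]-th exhaustion set: [1 / E <= rho] is below
   its distance to the complement of [U], and the other summands bound its coordinates. *)
pose bd := rho^-1 + `|complex.Re u| + `|complex.Im u| + rho.
have bd0 : 0 <= bd by rewrite !addr_ge0 ?invr_ge0 // ltW.
pose e0 := (Num.Def.archi_bound bd).+1.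
have be0 : bd < e0%:R.
  by apply: lt_trans (archi_boundP bd0) _; rewrite ltr_nat.
pose T x0 x1 y0 y1 H e : 7.-tuple nat :=
  [tuple ((H * x0).+1 - H * x1)%N; (H * x1 - (H * x0).+1)%N; (H ^ 2)%N;
         ((H * y0).+1 - H * y1)%N; (H * y1 - (H * y0).+1)%N; (H ^ 2)%N;
         (e + e0)%N].
pose k01 (s : bool) : 'I_3 := if s then 0 else 1; pose k2 : 'I_3 := 2.
pose G (j s : bool) x0 x1 y0 y1 H e :=
  (g (j, k01 s) (T x0 x1 y0 y1 H e) * e %/
   g (j, k2) (T x0 x1 y0 y1 H e))%N.
(* One third of [1 / d0 E] covers the distance to the grid point and another the shift [1 / H ^ 2]
   made by [reduced_frac]; the remaining third makes the inequality strict. *)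
exists (fun e => 3 * d0 (e + e0))%N, G; split.
- move=> n a Ca; apply: in_class_mul => //; first exact: in_class_cst.
  by apply: cd0; apply: in_class_add => //; exact: in_class_cst.
- move=> j s n a1 a2 a3 a4 a5 a6 c1 c2 c3 c4 c5 c6.
  have cT k : C n (fun x => g (j, k) (T (a1 x) (a2 x) (a3 x) (a4 x) (a5 x) (a6 x))).
    have [Cg _] := Hg (j, k).
    have cS b : C n b -> C n (fun x => (a5 x * b x).+1).
      by move=> cb; apply: in_class_succ => //; exact: in_class_mul.
    have cM b : C n b -> C n (fun x => (a5 x * b x)%N).
      by move=> cb; exact: in_class_mul.
    apply: (in_class_comp7 hC Cg); try exact: in_class_exp.
    + exact: in_class_monus (cS _ c1) (cM _ c2).
    + exact: in_class_monus (cM _ c2) (cS _ c1).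
    + exact: in_class_monus (cS _ c3) (cM _ c4).
    + exact: in_class_monus (cM _ c4) (cS _ c3).
    + by apply: in_class_add => //; exact: in_class_cst.
  by apply: in_class_div => //; apply: in_class_mul => //; exact: cT.
- by move=> e e_gt0; rewrite muln_gt0 /=; apply: d00; rewrite ltn_addr.
move=> e H x0 x1 y0 y1 z e_gt0 dH zin zx zy j.
set E := (e + e0)%N in dH zx zy.
have E_gt0 : (0 < E)%N by rewrite ltn_addr.
have dE0 : (0 < d0 E)%N by exact: d00.
have H_gt0 : (0 < H)%N by apply: leq_trans dH; rewrite muln_gt0.
have HR : 0 < H%:R :> R by rewrite ltr0n.
have dR : 0 < (d0 E)%:R :> R by rewrite ltr0n.
pose a : 'rV[rat]_2 := \row_i (if i == 0 then reduced_frac H x0 x1 else reduced_frac H y0 y1).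
have aT : arg_code a E = T x0 x1 y0 y1 H e.
  by rewrite arg_code2 !mxE /= !rat_code_frac.
have near (w : R) a0 a1 : `|w - grid_value R a0 a1 H| <= (3 * d0 E)%:R^-1 ->
    `|w - ratr (reduced_frac H a0 a1)| < (d0 E)%:R^-1.
  move=> wn; rewrite ratr_frac // opprD addrA.
  have hH : (H%:R ^+ 2)^-1 <= (3 * d0 E)%:R^-1 :> R.
    rewrite -natrX lef_pV2 ?posrE ?ltr0n ?expn_gt0 ?H_gt0 ?muln_gt0 // ler_nat.
    by apply: leq_trans dH _; rewrite -[leqLHS]expn1 leq_pexp2l.
  apply: le_lt_trans (ler_normB _ _) _.
  have h0 : 0 < (H%:R ^+ 2)^-1 :> R by rewrite invr_gt0 exprn_gt0.
  rewrite (gtr0_norm h0).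
  apply: le_lt_trans (lerD wn hH) _; rewrite natrM invfM.
  have : 0 < (d0 E)%:R^-1 :> R by rewrite invr_gt0.
  by set D := (d0 E)%:R^-1; lra.
pose x := plane_of_complex z.
have xin : exhaustion (plane_set U) E x.
  have E0 : e0%:R <= E%:R :> R by rewrite ler_nat leq_addl.
  have ER : 0 < E%:R :> R by rewrite ltr0n.
  have rE : rho^-1 <= E%:R by apply: le_trans E0; apply: ltW; apply: le_lt_trans be0;
    rewrite /bd -!addrA lerDl !addr_ge0 // ltW.
  have rE' : E%:R^-1 <= rho by rewrite -[leRHS]invrK lef_pV2 ?posrE ?invr_gt0.
  case: zin => zin1 zin2; split.
  - by exists z => //; apply: uU; split; lra.
  - apply: ltW; apply: row2_lt => //.
      rewrite (plane_of_complexE z true) /=.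
      have := ler_normD (complex.Re z - complex.Re u) (complex.Re u).
      rewrite subrK; have : 0 < rho^-1 by rewrite invr_gt0.
      by have := normr_ge0 (complex.Im u); move: be0; rewrite /bd; lra.
    rewrite (plane_of_complexE z false) /=.
    have := ler_normD (complex.Im z - complex.Im u) (complex.Im u).
    rewrite subrK; have : 0 < rho^-1 by rewrite invr_gt0.
    by have := normr_ge0 (complex.Re u); move: be0; rewrite /bd; lra.
  - apply: le_ereal_inf_tmp => _ [y yU <-]; rewrite lee_fin.
    pose w : K := (y 0 0 +i* y 0 1)%C.
    have wU : ~ box u (2 * rho) w.
      by move=> /uU Uw; apply: yU; exists w => //; exact: plane_of_complexK.
    have n0 := row2_ge (x - y) (coord true); have n1 := row2_ge (x - y) (coord false).
    have Ex j' : (x - y) 0 (coord j') = part j' z - part j' w.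
      by rewrite -!plane_of_complexE plane_of_complexK !mxE.
    rewrite !Ex /= in n0 n1.
    have tri (s t v : R) : `|t - v| <= rho -> 2 * rho < `|s - v| -> rho <= `|t - s|.
      move=> tv sv; have := ler_normD (s - t) (t - v); rewrite addrA subrK (distrC s t).
      by lra.
    apply: le_trans rE' _.
    have [wr|wr] := leP `|complex.Re w - complex.Re u| (2 * rho); last first.
      by apply: le_trans n0; apply: tri wr.
    have [wi|wi] := leP `|complex.Im w - complex.Im u| (2 * rho); last first.
      by apply: le_trans n1; apply: tri wi.
    by exfalso; apply: wU.
have /(_ _) Fx := Hf E a x E_gt0 xin.
have {}Fx : `|plane_fun F x - map_mx ratr (f a E)| < E%:R^-1.
  apply: Fx; apply: row2_lt; first by rewrite invr_gt0.
    rewrite mxE [X in _ + X]mxE [X in - X]mxE (plane_of_complexE z true) mxE /=.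
    exact: near.
  rewrite mxE [X in _ + X]mxE [X in - X]mxE (plane_of_complexE z false) mxE /=.
  exact: near.
have {}Fx := le_lt_trans (row2_ge _ (coord j)) Fx.
rewrite plane_fun_plane mxE plane_of_complexE mxE mxE in Fx.
have [p [n [dd [cpn dd0 ratrE]]]] := ratr_code R (f a E 0 (coord j)).
rewrite ratrE in Fx.
have gE k : g (j, k) (T x0 x1 y0 y1 H e) = tnth [tuple p; n; dd] k.
  by rewrite -aT (proj2 (Hg (j, k))) /= cpn.
rewrite /G !gE /=.
have fl := floor_scaled R p n dd0 e_gt0.
have Ee : E%:R^-1 <= e%:R^-1 :> R.
  by rewrite lef_pV2 ?posrE ?ltr0n // ler_nat leq_addr.
(* One [1 / e] is the error of [f], the other that of rounding its value to denominator [e]. *)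
have e2 : 2 / e%:R = e%:R^-1 + e%:R^-1 :> R by rewrite mulr_natl mulr2n.
rewrite e2; set q := (p%:R - n%:R) / dd%:R in Fx fl.
set gv := grid_value _ _ _ _ in fl *.
have := ler_normD (part j (F z) - q) (q - gv).
by rewrite addrA subrK; lra.
Qed.

Lemma compact_of_grid_approx (F : R[i]^o -> R[i]^o) (A : set R[i]^o) :
  grid_approx C F A -> in_class_on_compact C (plane_set A) (plane_fun F).
Proof.
move=> [d [G [cd cG d0 H]]].
(* The output errs by [2 / Q] on the grid and by [1 / Q ^ 2] in [reduced_frac], at most
   [3 / Q < 1 / e] together. On the input side, [1 / D] is spent on the distance to [a] and [1 / D]
   on rounding [a] to the grid, which adds up to [1 / d (Q e)]. *)
pose Q e := (4 * e.+1)%N; pose D e := (2 * d (Q e))%N.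
pose Gc j s (p0 n0 q0 p1 n1 q1 e : nat) := G j s (p0 * D e %/ q0)%N
  (n0 * D e %/ q0)%N (p1 * D e %/ q1)%N (n1 * D e %/ q1)%N (D e) (Q e).
pose Ga j s (a : 'rV[rat]_2) e := Gc j s
  (tnth (rat_code (a 0 0)) 0) (tnth (rat_code (a 0 0)) 1) (tnth (rat_code (a 0 0)) 2)
  (tnth (rat_code (a 0 1)) 0) (tnth (rat_code (a 0 1)) 1) (tnth (rat_code (a 0 1)) 2) e.
pose f a e : 'rV[rat]_2 :=
  \row_i reduced_frac (Q e) (Ga (i == 0) true a e) (Ga (i == 0) false a e).
have cQ : closed1 C Q.
  by move=> n a Ca; apply: in_class_mul; [|exact: in_class_cst|exact: in_class_succ].
have cD : closed1 C D.
  move=> n a Ca; apply: in_class_mul; [by []|exact: in_class_cst|].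
  exact/cd/cQ.
have Q0 e : (0 < Q e)%N by [].
exists D, f; split.
- by apply: cD; exact: good_proj.
- move=> i k; pose j := i == 0; pose o6 : 'I_7 := 6.
  pose Gt s (x : 7.-tuple nat) := Gc j s (tnth x 0) (tnth x 1) (tnth x 2)
    (tnth x 3) (tnth x 4) (tnth x 5) (tnth x o6).
  have CG s : C 7%N (Gt s).
    have pr (o : 'I_7) : C 7%N (fun x => tnth x o) by exact: good_proj.
    have pD : C 7%N (fun x => D (tnth x o6)) by apply: cD; exact: pr.
    have dv (o o' : 'I_7) : C 7%N (fun x => tnth x o * D (tnth x o6) %/ tnth x o')%N.
      by apply: in_class_div => //; apply: in_class_mul.
    by apply: cG; rewrite //; apply: cQ; exact: pr.
  have C6 : C 7%N (fun x => Q (tnth x o6)) by apply: cQ; exact: good_proj.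
  have GtE s (a : 'rV[rat]_2) e : Gt s (arg_code a e) = Ga j s a e by rewrite arg_code2.
  have EQ (a : 'rV[rat]_2) e : tnth (arg_code a e) o6 = e by rewrite arg_code2.
  have CS s : C 7%N (fun x => (Q (tnth x o6) * Gt s x))%N by exact: in_class_mul.
  have CS1 s : C 7%N (fun x => (Q (tnth x o6) * Gt s x).+1)%N by exact: in_class_succ.
  have fE a e : tnth (rat_code (f a e 0 i)) k =
      tnth [tuple ((Q e * Ga j true a e).+1 - Q e * Ga j false a e)%N;
              (Q e * Ga j false a e - (Q e * Ga j true a e).+1)%N; (Q e ^ 2)%N] k.
    by rewrite mxE rat_code_frac.
  case: k fE => [[|[|[|//]]]] ltk fE.
  + exists (fun x => (Q (tnth x o6) * Gt true x).+1 - Q (tnth x o6) * Gt false x)%N.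
      exact: in_class_monus.
    by move=> a e; rewrite fE EQ !GtE.
  + exists (fun x => Q (tnth x o6) * Gt false x - (Q (tnth x o6) * Gt true x).+1)%N.
      exact: in_class_monus.
    by move=> a e; rewrite fE EQ !GtE.
  + exists (fun x => Q (tnth x o6) ^ 2)%N; first exact: in_class_exp.
    by move=> a e; rewrite fE EQ.
- by move=> e _; rewrite muln_gt0 /= d0.
move=> e a x e_gt0 [z Az <-] xa.
have D0 : (0 < D e)%N by rewrite muln_gt0 /= d0.
have dQ : (0 < d (Q e))%N by exact: d0.
have dR : 0 < (d (Q e))%:R :> R by rewrite ltr0n.
have near j : exists p n q, rat_code (a 0 (coord j)) = [tuple p; n; q] /\
    `|part j z - grid_value R (p * D e %/ q) (n * D e %/ q) (D e)| <= (d (Q e))%:R^-1.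
  have [p [n [q [E q0 qE]]]] := ratr_code R (a 0 (coord j)).
  exists p, n, q; split=> //.
  have := le_lt_trans (row2_ge _ (coord j)) xa.
  rewrite mxE plane_of_complexE mxE mxE qE => pj.
  have := floor_scaled R p n q0 D0; set gv := grid_value _ _ _ _; set w := _ / _ => fl.
  have -> : (d (Q e))%:R^-1 = (D e)%:R^-1 + (D e)%:R^-1 :> R.
    by rewrite /D natrM; field; rewrite gt_eqF.
  have := ler_normD (part j z - w) (w - gv).
  by rewrite addrA subrK; move: pj; rewrite -/w; lra.
have [p0 [n0 [q0 [E0 h0]]]] := near true; have [p1 [n1 [q1 [E1 h1]]]] := near false.
have HF := H (Q e) (D e) _ _ _ _ z (Q0 e) (leq_pmull _ (isT : 0 < 2)%N) Az h0 h1.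
pose W j s := G j s (p0 * D e %/ q0)%N (n0 * D e %/ q0)%N (p1 * D e %/ q1)%N
  (n1 * D e %/ q1)%N (D e) (Q e).
have val j : `|part j (F z) - ratr (f a e 0 (coord j))| < e%:R^-1.
  have -> : f a e 0 (coord j) = reduced_frac (Q e) (W j true) (W j false).
    by rewrite mxE /Ga -/(coord true) -/(coord false) E0 E1; case: j.
  rewrite ratr_frac // opprD addrA; apply: le_lt_trans (ler_normB _ _) _.
  apply: le_lt_trans (lerD (HF j) (lexx _)) _.
  have eR : 0 < e%:R :> R by rewrite ltr0n.
  have QE : (Q e)%:R = 4 * (e%:R + 1) :> R by rewrite /Q natrM -[e.+1%:R]natr1.
  have QR : 4 <= (Q e)%:R :> R by rewrite QE; lra.
  have Q00 : 0 < (Q e)%:R :> R by lra.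
  rewrite ger0_norm ?invr_ge0 ?exprn_ge0 ?ler0n //.
  apply: (@le_lt_trans _ _ (3 / (Q e)%:R)).
    have -> : 3 / (Q e)%:R = 2 / (Q e)%:R + (Q e)%:R^-1 :> R by field; rewrite gt_eqF.
    rewrite lerD2l lef_pV2 ?posrE ?exprn_gt0 // expr2 ler_peMl ?(ltW Q00) //.
    by lra.
  rewrite ltr_pdivrMr // mulrC ltr_pdivlMr // QE; lra.
apply: row2_lt; first by rewrite invr_gt0 ltr0n.
  rewrite plane_fun_plane mxE [X in _ + X]mxE [X in - X]mxE.
  by rewrite (plane_of_complexE (F z) true); exact: (val true).
rewrite plane_fun_plane mxE [X in _ + X]mxE [X in - X]mxE.
by rewrite (plane_of_complexE (F z) false); exact: (val false).
Qed.

End Conversions.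

(** * Gluing approximations *)

Section Gluing.
Variables (R : realType) (C : function_class) (hC : good_class C).
Arguments C : clear implicits.
Local Notation K := (R[i]).

Lemma exists_grid (x : R) (q : nat) : (0 < q)%N ->
  exists c0 c1, `|x - grid_value R c0 c1 q| <= q%:R^-1.
Proof.
move=> q0; have qR : 0 < q%:R :> R by rewrite ltr0n.
have [m1 m2] : (Num.floor (x * q%:R))%:~R <= x * q%:R /\
    x * q%:R < (Num.floor (x * q%:R))%:~R + 1.
  have /andP[h1 h2] := mem_rg1_floor (x * q%:R); split=> //.
have [c0 [c1 E]] : exists c0 c1 : nat,
    (Num.floor (x * q%:R))%:~R = c0%:R - c1%:R :> R.
  case: (Num.floor _) => n; [exists n, 0%N|exists 0%N, n.+1].
    by rewrite subr0 pmulrn.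
  by rewrite NegzE mulrNz sub0r pmulrn.
exists c0, c1; rewrite /grid_value -E.
rewrite -(ler_pM2r qR) mulVf ?gt_eqF // -[X in _ * X <= _](gtr0_norm qR) -normrM.
by rewrite mulrBl divfK ?gt_eqF // ler_norml; lra.
Qed.

(** Denominators are cleared and negative terms moved across, so that the comparison takes place in
    the naturals and the class can decide it. *)
Lemma grid_test (x0 x1 H c0 c1 q r : nat) : (0 < H)%N -> (0 < q)%N ->
  (`|grid_value R x0 x1 H - grid_value R c0 c1 q| <= r%:R / q%:R) =
  ((q * x0 + H * c1 <= q * x1 + H * c0 + H * r)%N &&
   (q * x1 + H * c0 <= q * x0 + H * c1 + H * r)%N).
Proof.
move=> H0 q0; have HR : 0 < H%:R :> R by rewrite ltr0n.
have qR : 0 < q%:R :> R by rewrite ltr0n.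
have HqR : 0 < H%:R * q%:R :> R by rewrite mulr_gt0.
rewrite -(ler_pM2r HqR) -[X in _ * X <= _](gtr0_norm HqR) -normrM /grid_value.
have -> : ((x0%:R - x1%:R) / H%:R - (c0%:R - c1%:R) / q%:R) * (H%:R * q%:R) =
    q%:R * x0%:R + H%:R * c1%:R - (q%:R * x1%:R + H%:R * c0%:R) :> R.
  by field; rewrite !gt_eqF.
have -> : r%:R / q%:R * (H%:R * q%:R) = H%:R * r%:R :> R by field; rewrite gt_eqF.
rewrite -!natrM -!natrD ler_norml lerBlDr -natrD lerNl opprB lerBlDr -natrD.
by rewrite !ler_nat andbC; congr (_ && _); congr (_ <= _)%N; lia.
Qed.

Definition box_test (c0 c1 b0 b1 q x0 x1 y0 y1 H : nat) : bool :=
  ((q * x0 + H * c1 <= q * x1 + H * c0 + H * 3) *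
   (q * x1 + H * c0 <= q * x0 + H * c1 + H * 3) *
   ((q * y0 + H * b1 <= q * y1 + H * b0 + H * 3) *
    (q * y1 + H * b0 <= q * y0 + H * b1 + H * 3)) == 1)%N.

Lemma box_testE (c0 c1 b0 b1 q x0 x1 y0 y1 H : nat) : (0 < H)%N -> (0 < q)%N ->
  box_test c0 c1 b0 b1 q x0 x1 y0 y1 H =
  (`|grid_value R x0 x1 H - grid_value R c0 c1 q| <= 3%:R / q%:R) &&
  (`|grid_value R y0 y1 H - grid_value R b0 b1 q| <= 3%:R / q%:R).
Proof.
by move=> H0 q0; rewrite !grid_test // /box_test !mulnb eqb1.
Qed.

Lemma in_class_box_test (c0 c1 b0 b1 q n : nat) (x0 x1 y0 y1 H : n.-tuple nat -> nat) :
  C n x0 -> C n x1 -> C n y0 -> C n y1 -> C n H ->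
  C n (fun x => box_test c0 c1 b0 b1 q (x0 x) (x1 x) (y0 x) (y1 x) (H x) : nat).
Proof.
move=> Cx0 Cx1 Cy0 Cy1 CH.
have half u0 u1 k0 k1 : C n u0 -> C n u1 -> C n (fun x =>
    (q * u0 x + H x * k1 <= q * u1 x + H x * k0 + H x * 3)%N : nat).
  have cst k : C n (fun=> k) by exact: in_class_cst.
  move=> cu0 cu1; apply: in_class_leq => //.
    by apply: in_class_add => //; apply: in_class_mul.
  by apply: in_class_add => //; [apply: in_class_add => //|]; apply: in_class_mul.
apply: in_class_eqn => //; last exact: in_class_cst.
apply: in_class_mul => //; apply: in_class_mul => //; exact: half.
Qed.

Definition good_point (F : K -> K) (p : K) : Prop :=
  exists2 rho : R, 0 < rho & grid_approx C F (box p rho).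

Lemma inv_nat_le (a b : nat) : (0 < a)%N -> (a <= b)%N -> b%:R^-1 <= a%:R^-1 :> R.
Proof.
move=> a0 ab; rewrite lef_pV2 ?posrE ?ltr0n // ?ler_nat //; exact: leq_trans ab.
Qed.

(* Whether a grid point lies in a slightly larger rational box is decided inside
   the class. *)
Lemma grid_approx_glue (F : K -> K) (p : K) : good_point F p ->
  exists2 r : R, 0 < r & forall A, grid_approx C F A ->
    grid_approx C F (box p r `|` A).
Proof.
move=> [rho rho0 [d1 [G1 [cd1 cG1 d10 H1]]]].
(* The grid centre is within [1 / q] of [p], and the grid input within [1 / q] of [z]. A point of
   the box of radius [1 / q] thus passes the test of radius [3 / q], and a point that passes lies
   within [5 / q <= rho] of [p], where [G1] is valid. *)
pose q := (Num.Def.archi_bound (5 / rho)).+1.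
have q0 : (0 < q)%N by [].
have qR : 0 < q%:R :> R by rewrite ltr0n.
have q5 : 5 / q%:R <= rho.
  rewrite ler_pdivrMr // mulrC -ler_pdivrMr //; apply/ltW.
  have : 0 <= 5 / rho by rewrite divr_ge0 // ltW.
  by move=> /archi_boundP h; apply: lt_trans h _; rewrite ltr_nat.
have [c0 [c1 hc]] := exists_grid (complex.Re p) q0.
have [b0 [b1 hb]] := exists_grid (complex.Im p) q0.
exists q%:R^-1; first by rewrite invr_gt0.
move=> A [d2 [G2 [cd2 cG2 d20 H2]]].
exists (fun e => d1 e + d2 e + q)%N, (fun j s x0 x1 y0 y1 H e =>
  if box_test c0 c1 b0 b1 q x0 x1 y0 y1 H
  then G1 j s x0 x1 y0 y1 H e else G2 j s x0 x1 y0 y1 H e); split.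
- move=> n a Ca; apply: in_class_add => //; last exact: in_class_cst.
  by apply: in_class_add => //; [exact: cd1|exact: cd2].
- move=> j s n a1 a2 a3 a4 a5 a6 c1' c2' c3' c4' c5' c6'.
  apply: in_class_if => //; [exact: in_class_box_test|exact: cG1|exact: cG2].
- by move=> e _; rewrite addn_gt0 orbT.
move=> e H x0 x1 y0 y1 z e0 dH zA zx zy j.
have d1e : (d1 e <= d1 e + d2 e + q)%N by rewrite -addnA leq_addr.
have d2e : (d2 e <= d1 e + d2 e + q)%N by rewrite addnAC leq_addl.
have qe : (q <= d1 e + d2 e + q)%N by rewrite leq_addl.
have H0 : (0 < H)%N by apply: leq_trans dH; exact: leq_trans qe.
have i1 := inv_nat_le (d10 e e0) d1e.
have i2 := inv_nat_le (d20 e e0) d2e.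
have iq := inv_nat_le q0 qe.
rewrite box_testE //; set gx := grid_value R x0 x1 H in zx *.
set gy := grid_value R y0 y1 H in zy *.
have [q3 q5'] : 3%:R / q%:R = q%:R^-1 + q%:R^-1 + q%:R^-1 :> R /\
    5 / q%:R = q%:R^-1 + q%:R^-1 + q%:R^-1 + q%:R^-1 + q%:R^-1 :> R.
  by split; field; rewrite gt_eqF.
set iqv := q%:R^-1 in hc hb iq q3 q5' zA.
set cx := grid_value R c0 c1 q in hc *; set cy := grid_value R b0 b1 q in hb *.
rewrite q3; case: ifP => [/andP[tx ty]|].
  apply: H1 => //; [exact: leq_trans dH| |exact: le_trans zx i1|exact: le_trans zy i1].
  rewrite q5' in q5.
  move: hc hb tx ty zx zy; rewrite !ler_norml => hc hb tx ty zx zy.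
  by split; rewrite ler_norml; lra.
(* A failed test excludes the small box, so [z] belongs to [A]. *)
move=> out; apply: H2 => //;
  [exact: leq_trans dH| |exact: le_trans zx i2|exact: le_trans zy i2].
case: zA => // -[bx by']; exfalso; move/negP: out; apply.
move: hc hb bx by' zx zy; rewrite !ler_norml => hc hb bx by' zx zy.
by apply/andP; split; lra.
Qed.

Lemma box_in_cnorm (p z : K) (r : R) : cnorm (z - p) < r -> box p r z.
Proof.
move=> zr; split; apply: ltW; apply: le_lt_trans zr.
  by rewrite -ReN -ReD; exact: Re_le_cnorm.
by rewrite -ImN -ImD; exact: Im_le_cnorm.
Qed.

(** The radius given by [grid_approx_glue] is the same for every set to be enlarged, so a finite
    cover can be fixed first and its boxes then added one by one to the empty set. *)
Lemma grid_approx_compact (F : R[i]^o -> R[i]^o) (A : set R[i]^o) :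
  compact A -> (forall p, A p -> good_point F p) -> grid_approx C F A.
Proof.
rewrite compact_cover => cA gA.
have /choice[r Hr] : forall p : K, exists r : R, A p ->
    0 < r /\ forall B, grid_approx C F B -> grid_approx C F (box p r `|` B).
  move=> p; have [Ap|nAp] := pselect (A p); last by exists 0.
  by have [r r0 Hr] := grid_approx_glue (gA _ Ap); exists r.
pose f (p : R[i]^o) : set R[i]^o := [set z | cnorm (z - p) < r p].
have fop (p : R[i]^o) : A p -> open (f p).
  move=> Ap; rewrite openE => z fz; apply/nbhs_cnormP.
  exists (r p - cnorm (z - p)); first by rewrite subr_gt0.
  move=> w wz; rewrite /f /=.
  have -> : w - p = (w - z) + (z - p) by rewrite addrA subrK.
  by apply: le_lt_trans (cnormD _ _) _; lra.
have [D' sD cD] : finite_subset_cover A f A.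
  apply: cA => // p Ap; exists p => //.
  by rewrite /f /= subrr cnorm0; have [] := Hr p Ap.
have {}cD : A `<=` [set z | exists2 p, p \in finmap.enum_fset D' & box p (r p) z].
  by move=> z /cD[p /= pD fz]; exists p => //; exact: box_in_cnorm.
have {}sD : {subset finmap.enum_fset D' <= A} by move=> p pD; apply: sD.
apply: grid_approx_sub cD _.
elim: (finmap.enum_fset D') sD => [|p s IHs] sD.
  by apply: grid_approx_sub (grid_approx_set0 hC F) => z [p]; rewrite in_nil.
have Ap : A p by apply/set_mem; apply: sD; rewrite mem_head.
have [_ Hp] := Hr p Ap.
apply: grid_approx_sub (Hp _ (IHs _)); last first.
  by move=> w ws; apply: sD; rewrite in_cons ws orbT.
move=> z [w]; rewrite in_cons => /predU1P[->|ws] zw; first by left.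
by right; exists w.
Qed.

End Gluing.

(** * Extrapolation inside the class *)

Section Extrapolation.
Variables (R : realType) (C : function_class) (hC : good_class C).
Arguments C : clear implicits.
Local Notation K := (R[i]).

Lemma sum_bin_exp (n : nat) : (\sum_(0 <= i < n.+1) 'C(n, i) = 2 ^ n)%N.
Proof.
rewrite -[in RHS](addn1 1) expnDn big_mkord; apply: eq_bigr => i _.
by rewrite !exp1n !muln1.
Qed.

Lemma partD j (z w : K) : part j (z + w) = part j z + part j w.
Proof. by case: j; rewrite /= ?ReD ?ImD. Qed.

Lemma partB j (z w : K) : part j (z - w) = part j z - part j w.
Proof. by case: j; rewrite /= ?ReD ?ImD ?ReN ?ImN. Qed.

Lemma part_sum j (I : Type) (s : seq I) (P : pred I) (f : I -> K) :
  part j (\sum_(i <- s | P i) f i) = \sum_(i <- s | P i) part j (f i).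
Proof. by apply: (big_morph _ (partD j)); case: j. Qed.

Lemma partZ j (u : R) (z : K) : part j ((u%:C)%C * z) = u * part j z.
Proof. by case: j; rewrite /= ?ReM ?ImM /= mul0r ?subr0 ?addr0. Qed.

Lemma part_le_cnorm j (z : K) : `|part j z| <= cnorm z.
Proof. by case: j; [exact: Re_le_cnorm|exact: Im_le_cnorm]. Qed.

Definition weight (N k i : nat) : R := ('C(N, k))%:R * ((-1) ^+ i * ('C(N - k, i))%:R).

Lemma part_extrapolation j (F : K -> K) (d : K) (m n : nat) (z : K) :
  part j (extrapolation F d m n z) =
  \sum_(m <= k < (m + n).+1) \sum_(0 <= i < (m + n - k).+1)
    weight (m + n) k i * part j (F (z + d *+ (k + i))).
Proof.
rewrite part_sum; apply: eq_bigr => k _; rewrite part_sum; apply: eq_bigr => i _.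
rewrite -partZ; congr (part j (_ * _)).
by rewrite /weight !rmorphM rmorphXn rmorphN1 !rmorph_nat.
Qed.

(** The total weight is the factor by which errors at the nodes are amplified. It is bounded by
    [(2 ^ N) ^ 2], in order to be compared with [ext_bound ^ 2]. *)
Lemma sum_weight_le (m n : nat) :
  \sum_(m <= k < (m + n).+1) \sum_(0 <= i < (m + n - k).+1) `|weight (m + n) k i|
  <= (4 ^ (m + n))%:R.
Proof.
set N := (m + n)%N.
have le1 : \sum_(m <= k < N.+1) \sum_(0 <= i < (N - k).+1) `|weight N k i| <=
    \sum_(0 <= k < N.+1) \sum_(0 <= i < (N - k).+1) `|weight N k i|.
  rewrite [leRHS](@big_cat_nat _ _ _ m) //=; last by rewrite leqW // leq_addr.
  by rewrite lerDr; do 2 apply: sumr_ge0 => ? _.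
apply: le_trans le1 _.
have wE k i : `|weight N k i| = ('C(N, k) * 'C(N - k, i))%:R.
  by rewrite /weight !normrM normrX normrN1 expr1n mul1r !normr_nat natrM.
under eq_bigr do under eq_bigr do rewrite wE.
under eq_bigr do rewrite -natr_sum.
rewrite -natr_sum ler_nat (_ : 4 = 2 * 2)%N // expnMn -{2}sum_bin_exp.
rewrite big_distrr /=; apply: leq_sum => k _.
by rewrite -big_distrr /= sum_bin_exp mulnC leq_mul2r leq_exp2l // leq_subr orbT.
Qed.

Variables (c a S v0 v1 w0 w1 : nat).
Variable G : bool -> bool -> nat -> nat -> nat -> nat -> nat -> nat -> nat.
Hypothesis cG : forall j s, closed6 C (G j s).

(** For positive [c] and [e], [c e < 2 ^ ext_n <= 2 c e]: the first inequality controls the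
    truncation error, the second keeps [2 ^ ext_N] below [ext_bound], which is polynomial in [e]
    since [a] is fixed. *)
Definition ext_n e := (trunc_log 2 (c * e)).+1.
Definition ext_N e := (a * ext_n e + ext_n e)%N.
Definition ext_bound e := ((2 * c * e) ^ a.+1)%N.
(** Node errors of [2 / ext_prec], amplified by a total weight of at most [ext_bound ^ 2], sum to at
    most [1 / (2 e)]. *)
Definition ext_prec e := (4 * e * ext_bound e ^ 2)%N.
Definition ext_den e := (S * (a * ext_n e))%N.

(** The grid input moved by [l] steps [v / (a n)], over the common denominator [ext_den e * H]. *)
Definition ext_node j s x0 x1 y0 y1 H e l :=
  G j s (ext_den e * x0 + l * (H * v0))%N (ext_den e * x1 + l * (H * v1))%N
        (ext_den e * y0 + l * (H * w0))%N (ext_den e * y1 + l * (H * w1))%N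
        (ext_den e * H)%N (ext_prec e).

(** The sign [(-1) ^ i] is realised by exchanging the positive and negative parts of the node value,
    which keeps everything in the naturals. *)
Definition ext_term j s x0 x1 y0 y1 H e k i :=
  (bin_below (ext_bound e) (ext_N e) k * bin_below (ext_bound e) (ext_N e - k) i *
   (if odd i then ext_node j (~~ s) x0 x1 y0 y1 H e (k + i)
    else ext_node j s x0 x1 y0 y1 H e (k + i)))%N.

Definition ext_row j s x0 x1 y0 y1 H e k :=
  (\sum_(0 <= i < (ext_N e - k).+1) ext_term j s x0 x1 y0 y1 H e k i)%N.

Definition ext_sum j s x0 x1 y0 y1 H e :=
  (\sum_(0 <= k < (ext_N e).+1)
     (a * ext_n e <= k) * ext_row j s x0 x1 y0 y1 H e k)%N.

Lemma closed1_ext_n : closed1 C ext_n.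
Proof.
move=> n x Cx; apply: in_class_succ => //; apply: in_class_trunc_log2 => //.
by apply: in_class_mul => //; exact: in_class_cst.
Qed.

Lemma closed1_ext_N : closed1 C ext_N.
Proof.
move=> n x Cx; have Cn := closed1_ext_n Cx.
by apply: in_class_add => //; apply: in_class_mul => //; exact: in_class_cst.
Qed.

Lemma closed1_ext_bound : closed1 C ext_bound.
Proof.
move=> n x Cx; apply: in_class_exp => //; apply: in_class_mul => //.
exact: in_class_cst.
Qed.

Lemma closed1_ext_prec : closed1 C ext_prec.
Proof.
move=> n x Cx; apply: in_class_mul => //.
  by apply: in_class_mul => //; exact: in_class_cst.
by apply: in_class_exp => //; exact: closed1_ext_bound.
Qed.

Lemma closed1_ext_den : closed1 C ext_den.
Proof.
move=> n x Cx; apply: in_class_mul => //; first exact: in_class_cst.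
apply: in_class_mul => //; first exact: in_class_cst.
exact: closed1_ext_n.
Qed.

Section Closure.
Variables (j s : bool) (n : nat) (x0 x1 y0 y1 H e : n.-tuple nat -> nat).
Hypotheses (Cx0 : C n x0) (Cx1 : C n x1) (Cy0 : C n y0) (Cy1 : C n y1)
  (CH : C n H) (Ce : C n e).

Lemma in_class_ext_node s' (l : n.-tuple nat -> nat) : C n l -> C n (fun x =>
  ext_node j s' (x0 x) (x1 x) (y0 x) (y1 x) (H x) (e x) (l x)).
Proof.
move=> Cl; have Cd := closed1_ext_den Ce.
have coor b k : C n b -> C n (fun x => ext_den (e x) * b x + l x * (H x * k))%N.
  move=> Cb; apply: in_class_add => //; first exact: in_class_mul.
  apply: in_class_mul => //; apply: in_class_mul => //; exact: in_class_cst.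
apply: cG; [exact: coor|exact: coor|exact: coor|exact: coor| |].
  exact: in_class_mul.
exact: closed1_ext_prec.
Qed.

Lemma in_class_ext_term (k i : n.-tuple nat -> nat) : C n k -> C n i -> C n (fun x =>
  ext_term j s (x0 x) (x1 x) (y0 x) (y1 x) (H x) (e x) (k x) (i x)).
Proof.
move=> Ck Ci; have CP := closed1_ext_bound Ce; have CN := closed1_ext_N Ce.
have Cki : C n (fun x => k x + i x)%N by exact: in_class_add.
apply: in_class_mul => //; first apply: in_class_mul => //.
- exact: in_class_bin_below.
- by apply: in_class_bin_below => //; exact: in_class_monus.
apply: in_class_if => //; first exact: in_class_odd.
- exact: in_class_ext_node.
- exact: in_class_ext_node.
Qed.

End Closure.

Lemma in_class_ext_row j s n (x0 x1 y0 y1 H e k : n.-tuple nat -> nat) :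
  C n x0 -> C n x1 -> C n y0 -> C n y1 -> C n H -> C n e -> C n k ->
  C n (fun x => ext_row j s (x0 x) (x1 x) (y0 x) (y1 x) (H x) (e x) (k x)).
Proof.
move=> Cx0 Cx1 Cy0 Cy1 CH Ce Ck.
apply: (in_class_sum hC (G := fun x i =>
  ext_term j s (x0 x) (x1 x) (y0 x) (y1 x) (H x) (e x) (k x) i)).
  apply: in_class_succ => //; apply: in_class_monus => //; exact: closed1_ext_N.
have fr f (Cf : C n f) := in_class_front hC Cf.
exact: (in_class_ext_term j s (fr _ Cx0) (fr _ Cx1) (fr _ Cy0) (fr _ Cy1) (fr _ CH)
  (fr _ Ce) (fr _ Ck) (in_class_final hC n)).
Qed.

Lemma closed6_ext_sum j s : closed6 C (ext_sum j s).
Proof.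
move=> n x0 x1 y0 y1 H e Cx0 Cx1 Cy0 Cy1 CH Ce.
have CN := closed1_ext_N Ce; have Cn := closed1_ext_n Ce.
apply: (in_class_sum hC (G := fun x k => (a * ext_n (e x) <= k) *
  ext_row j s (x0 x) (x1 x) (y0 x) (y1 x) (H x) (e x) k)%N).
  exact: in_class_succ.
apply: in_class_mul => //.
  apply: in_class_leq => //; last exact: in_class_final.
  apply: in_class_mul => //; first exact: in_class_cst.
  exact: (in_class_front hC Cn).
have fr f (Cf : C n f) := in_class_front hC Cf.
exact: (in_class_ext_row j s (fr _ Cx0) (fr _ Cx1) (fr _ Cy0) (fr _ Cy1) (fr _ CH)
  (fr _ Ce) (in_class_final hC n)).
Qed.

Section Values.
Variable e : nat.
Hypotheses (c_gt0 : (0 < c)%N) (e_gt0 : (0 < e)%N).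

Lemma ext_n_gt : (c * e < 2 ^ ext_n e)%N.
Proof. by apply: trunc_log_ltn. Qed.

Lemma ext_N_le : (2 ^ ext_N e <= ext_bound e)%N.
Proof.
rewrite /ext_N /ext_bound -mulSnr mulnC expnM leq_exp2r // /ext_n expnS.
rewrite -mulnA leq_mul2l /=.
by apply: trunc_logP => //; rewrite muln_gt0 c_gt0.
Qed.

Lemma ext_sumB j x0 x1 y0 y1 H :
  (ext_sum j true x0 x1 y0 y1 H e)%:R - (ext_sum j false x0 x1 y0 y1 H e)%:R =
  \sum_(a * ext_n e <= k < (ext_N e).+1) \sum_(0 <= i < (ext_N e - k).+1)
    weight (ext_N e) k i * ((ext_node j true x0 x1 y0 y1 H e (k + i))%:R -
                            (ext_node j false x0 x1 y0 y1 H e (k + i))%:R).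
Proof.
have sumE s : ext_sum j s x0 x1 y0 y1 H e =
    (\sum_(a * ext_n e <= k < (ext_N e).+1) ext_row j s x0 x1 y0 y1 H e k)%N.
  rewrite /ext_sum (big_nat_widenl (a * ext_n e) 0) // big_mkcond /=.
  by apply: eq_bigr => k _; case: leqP; rewrite ?mul1n ?mul0n.
rewrite !sumE !natr_sum -sumrB; apply: eq_big_nat => k /andP[_ kN].
rewrite !natr_sum -sumrB; apply: eq_big_nat => i _.
have le_pow l : (l <= ext_N e)%N -> (2 ^ l <= ext_bound e)%N.
  by move=> lN; apply: leq_trans ext_N_le; rewrite leq_exp2l.
rewrite /ext_term !bin_belowE ?le_pow ?leq_subr // /weight -signr_odd.
by case: (odd i); rewrite /= !natrM ?expr0 ?expr1; ring.
Qed.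

End Values.

End Extrapolation.

(** * Continuation from one box to a neighbouring one *)

Section Continuation.
Variables (R : realType) (C : function_class) (hC : good_class C).
Arguments C : clear implicits.
Local Notation K := (R[i]).

Definition grid_point (v0 v1 w0 w1 S : nat) : K :=
  (grid_value R v0 v1 S +i* grid_value R w0 w1 S)%C.

Lemma grid_value_div (v0 v1 S k l : nat) : (0 < S)%N -> (0 < k)%N ->
  grid_value R v0 v1 (S * k) *+ l = (l%:R / k%:R) * grid_value R v0 v1 S.
Proof.
move=> S0 k0; rewrite /grid_value -mulr_natl natrM.
by field; rewrite !pnatr_eq0 -!lt0n S0 k0.
Qed.

Lemma ReMn (z : K) l : complex.Re (z *+ l) = complex.Re z *+ l.
Proof. by elim: l => // l IHl; rewrite !mulrS ReD IHl. Qed.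

Lemma ImMn (z : K) l : complex.Im (z *+ l) = complex.Im z *+ l.
Proof. by elim: l => // l IHl; rewrite !mulrS ImD IHl. Qed.

Lemma grid_point_div (v0 v1 w0 w1 S k l : nat) : (0 < S)%N -> (0 < k)%N ->
  grid_point v0 v1 w0 w1 (S * k) *+ l =
  ((l%:R / k%:R)%:C)%C * grid_point v0 v1 w0 w1 S.
Proof.
move=> S0 k0; apply: complex_ext; rewrite ?ReMn ?ImMn ?ReM ?ImM /=.
  by rewrite mul0r subr0 grid_value_div.
by rewrite mul0r addr0 grid_value_div.
Qed.

Lemma grid_value_shift (x0 x1 v0 v1 D H l : nat) : (0 < D)%N -> (0 < H)%N ->
  grid_value R (D * x0 + l * (H * v0)) (D * x1 + l * (H * v1)) (D * H) =
  grid_value R x0 x1 H + grid_value R v0 v1 D *+ l.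
Proof.
move=> D0 H0; rewrite /grid_value -mulr_natl !natrD !natrM.
by field; rewrite !pnatr_eq0 -!lt0n D0 H0.
Qed.

(** The allowance [2 / e] is spent as [1 / (2 e)] on the truncation, [1 / (2 e)] on the node values
    and [1 / e] on rounding the result to denominator [e]. *)
Lemma grid_approx_extrapolation (F : K -> K) (x y r M rho : R)
    (v0 v1 w0 w1 S a : nat) (A : set K) :
  let v := grid_point v0 v1 w0 w1 S in
  0 < r ->
  (forall z, in_rect (x - r) (x + r) (y - r) (y + r) z -> cdiff F z) ->
  (forall z, in_rect (x - r) (x + r) (y - r) (y + r) z -> cnorm (F z) <= M) ->
  (0 < S)%N -> (0 < a)%N -> cnorm v <= r / 16 -> rho <= r / 8 ->
  (forall z t, box (x +i* y)%C rho z -> 1 <= t <= 1 + a%:R^-1 ->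
     A (z + (t%:C)%C * v)) ->
  grid_approx C F A -> grid_approx C F (box (x +i* y)%C rho).
Proof.
move=> v r0 F_diff F_bound S0 a0 vr rhor nodes [d [G [cd cG d0 HG]]].
have [B B0 HB] := extrapolation_error r0 F_diff F_bound.
(* With [2 B <= c], the inequality [c e < 2 ^ n] yields [B 2 ^ - n <= 1 / (2 e)]. *)
pose c := (Num.Def.archi_bound (2 * B)).+1.
have cB : 2 * B <= c%:R.
  have : 0 <= 2 * B by rewrite mulr_ge0.
  by move=> /archi_boundP/ltW h; apply: le_trans h _; rewrite ler_nat.
have c0 : (0 < c)%N by [].
have P_gt0 e : (0 < e)%N -> (0 < ext_bound c a e)%N.
  by move=> e0; rewrite /ext_bound expn_gt0 !muln_gt0 c0 e0.
pose prec := ext_prec c a.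
have pr_gt0 e : (0 < e)%N -> (0 < prec e)%N.
  move=> e0; rewrite /prec /ext_prec; move: (ext_bound c a e) (P_gt0 e e0) => b b0.
  by rewrite !muln_gt0 e0 b0.
pose sm := ext_sum c a S v0 v1 w0 w1 G.
exists (fun e => d (prec e)), (fun j s x0 x1 y0 y1 H e =>
  sm j s x0 x1 y0 y1 H e * e %/ prec e)%N; split.
- by move=> n b Cb; apply: cd; exact: closed1_ext_prec.
- move=> j s n a1 a2 a3 a4 a5 a6 c1 c2 c3 c4 c5 c6.
  apply: in_class_div => //; last exact: closed1_ext_prec.
  by apply: in_class_mul => //; exact: closed6_ext_sum.
- by move=> e e0; apply: d0; exact: pr_gt0.
move=> e H x0 x1 y0 y1 z e0 dH zin zx zy j.
set n := ext_n c e; set N := ext_N c a e; set D := ext_den c a S e.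
pose k := (a * n)%N.
have n0 : (0 < n)%N by [].
have k0 : (0 < k)%N by rewrite muln_gt0 a0.
have D0 : (0 < D)%N by rewrite muln_gt0 S0.
have NE : N = (k + n)%N by [].
have P0 := P_gt0 e e0; have pr0 := pr_gt0 e e0.
have H0 : (0 < H)%N by apply: leq_trans dH; exact: d0.
have kR : 0 < k%:R :> R by rewrite ltr0n.
have aR : 0 < a%:R :> R by rewrite ltr0n.
have nR : 0 < n%:R :> R by rewrite ltr0n.
have eR : 0 < e%:R :> R by rewrite ltr0n.
have prR : 0 < (prec e)%:R :> R by rewrite ltr0n.
pose dd := grid_point v0 v1 w0 w1 D.
have ddE l : dd *+ l = ((l%:R / k%:R)%:C)%C * v by exact: grid_point_div.
have NkE : N%:R / k%:R = 1 + a%:R^-1 :> R.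
  by rewrite NE natrD mulrDl divff ?gt_eqF // /k natrM; field; rewrite !gt_eqF.
have a1 : a%:R^-1 <= 1 :> R by rewrite invf_le1 // ler1n.
have fr l : (l <= N)%N -> 0 <= (l%:R / k%:R : R) <= 2.
  move=> lN; rewrite divr_ge0 //=; apply: (@le_trans _ _ (N%:R / k%:R)).
    by rewrite ler_pM2r ?invr_gt0 // ler_nat.
  by rewrite NkE; lra.
(* A shift is at most [2 |v| <= r / 8]; together with [rho <= r / 8] the nodes stay well inside the
   half-size square. *)
have small j' l : (l <= N)%N -> `|part j' (dd *+ l)| <= r / 8.
  move=> /fr/andP[l0 l2]; rewrite ddE partZ normrM (ger0_norm l0).
  have := le_trans (part_le_cnorm j' v) vr; have := normr_ge0 (part j' v).
  move=> p0 p1; apply: le_trans (ler_pM l0 p0 l2 p1) _; lra.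
have core l : (l <= N)%N -> (`|complex.Re (z + dd *+ l) - x| <= r / 2) &&
    (`|complex.Im (z + dd *+ l) - y| <= r / 2).
  move=> lN; case: zin => /= z1 z2.
  have s1 := small true _ lN; have s2 := small false _ lN; rewrite /= in s1 s2.
  move: z1 z2 s1 s2; rewrite ReD ImD !ler_norml => z1 z2 s1 s2.
  by apply/andP; split; lra.
(* [N |dd| <= (1 + 1 / a) |v| <= 2 (r / 16)]; this is where the constant 16 comes from. *)
have ndd : N%:R * (4 * cnorm dd / r) <= 2^-1.
  have -> : dd = ((1 / k%:R)%:C)%C * v by exact: (ddE 1%N).
  have le1 : cnorm (((1 / k%:R)%:C)%C * v) <= (1 / k%:R) * cnorm v.
    apply: le_trans (cnormM _ _) _; rewrite ler_wpM2r ?cnorm_ge0 //.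
    by rewrite /cnorm /= normr0 addr0 ger0_norm // divr_ge0.
  apply: (@le_trans _ _ (N%:R * (4 * ((1 / k%:R) * (r / 16)) / r))).
    rewrite ler_wpM2l // ler_wpM2r ?invr_ge0 ?(ltW r0) // ler_wpM2l //.
    by apply: le_trans le1 _; rewrite ler_wpM2l // divr_ge0.
  have -> : N%:R * (4 * ((1 / k%:R) * (r / 16)) / r) = (N%:R / k%:R) / 4.
    by field; rewrite !gt_eqF.
  by rewrite NkE; lra.
have err := HB dd k n z core ndd.
have {}err := le_trans (part_le_cnorm j _) err.
rewrite partB part_extrapolation -NE in err.
have n2 : B * 2^-1 ^+ n <= (2 * e%:R)^-1.
  have ce : c%:R * e%:R <= 2 ^+ n :> R.
    by rewrite -natrM -natrX ler_nat ltnW // ext_n_gt.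
  have p2 : 0 < 2 ^+ n :> R by rewrite exprn_gt0.
  rewrite exprVn ler_pdivrMr // mulrC ler_pdivlMr ?mulr_gt0 //.
  apply: le_trans ce; rewrite mulrA [B * 2]mulrC ler_wpM2r // ltW.
have node l i : let q := (l + i)%N in (k <= l)%N -> (q <= N)%N ->
    `|part j (F (z + dd *+ q)) - grid_value R
        (ext_node c a S v0 v1 w0 w1 G j true x0 x1 y0 y1 H e q)
        (ext_node c a S v0 v1 w0 w1 G j false x0 x1 y0 y1 H e q) (prec e)|
    <= 2 / (prec e)%:R.
  move=> q kl qN; apply: HG => //.
  - by apply: leq_trans dH _; rewrite leq_pmull.
  (* For a kept node the multiplier [t = q / k] of [v] runs between 1 and [N / k = 1 + 1 / a]. *)
  - rewrite ddE; apply: nodes => //; apply/andP; split.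
      by rewrite ler_pdivlMr // mul1r ler_nat (leq_trans kl) // leq_addr.
    by rewrite -NkE ler_pM2r ?invr_gt0 // ler_nat.
  - rewrite grid_value_shift // ReD ReMn.
    have -> // : forall s t u : R, s + t - (u + t) = s - u by move=> *; ring.
  - rewrite grid_value_shift // ImD ImMn.
    have -> // : forall s t u : R, s + t - (u + t) = s - u by move=> *; ring.
have fl := floor_scaled R (sm j true x0 x1 y0 y1 H e) (sm j false x0 x1 y0 y1 H e) pr0 e0.
have sE := @ext_sumB R c a S v0 v1 w0 w1 G e c0 e0 j x0 x1 y0 y1 H.
set tot := (_ - _) / (prec e)%:R in fl.
have totE : tot = \sum_(k <= l < N.+1) \sum_(0 <= i < (N - l).+1)
    weight R N l i * grid_value R
        (ext_node c a S v0 v1 w0 w1 G j true x0 x1 y0 y1 H e (l + i))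
        (ext_node c a S v0 v1 w0 w1 G j false x0 x1 y0 y1 H e (l + i)) (prec e).
  rewrite /tot sE mulr_suml; apply: eq_bigr => l _.
  by rewrite mulr_suml; apply: eq_bigr => i _; rewrite -mulrA.
have cmp : `|\sum_(k <= l < N.+1) \sum_(0 <= i < (N - l).+1)
    weight R N l i * part j (F (z + dd *+ (l + i))) - tot| <= (2 * e%:R)^-1.
  rewrite totE -sumrB; apply: le_trans (ler_norm_sum _ _ _) _.
  apply: (@le_trans _ _ (\sum_(k <= l < N.+1) \sum_(0 <= i < (N - l).+1)
      `|weight R N l i| * (2 / (prec e)%:R))).
    apply: ler_sum_nat => l /andP[kl lN]; rewrite -sumrB.
    apply: le_trans (ler_norm_sum _ _ _) _.
    apply: ler_sum_nat => i /andP[_ iN]; rewrite -mulrBr normrM ler_wpM2l //.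
    rewrite ltnS in lN; rewrite ltnS in iN.
    by apply: node => //; rewrite -[leqRHS](subnKC lN) leq_add2l.
  under eq_bigr do rewrite -mulr_suml.
  rewrite -mulr_suml; have := sum_weight_le R k n; rewrite -NE => sw.
  have pw : (4 ^ N)%:R <= (ext_bound c a e ^ 2)%:R :> R.
    rewrite ler_nat (_ : 4 = 2 ^ 2)%N // -expnM mulnC expnM leq_exp2r //.
    exact: ext_N_le.
  have pr2 : 0 <= 2 / (prec e)%:R :> R by rewrite divr_ge0.
  apply: le_trans (ler_wpM2r pr2 (le_trans sw pw)) _.
  rewrite /prec /ext_prec natrM natrM; set P2 := (ext_bound c a e ^ 2)%N%:R.
  have P20 : 0 < P2 :> R by rewrite ltr0n expn_gt0 P0.
  rewrite le_eqVlt; apply/orP; left; apply/eqP.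
  move: P2 P20 {pw} => P2 P20; field.
  by rewrite (gt_eqF eR) (gt_eqF P20).
have e2 : (2 * e%:R)^-1 + (2 * e%:R)^-1 + e%:R^-1 = 2 / e%:R :> R.
  by field; rewrite gt_eqF.
rewrite -e2; set gv := grid_value _ _ _ _ in fl *.
set ex := \sum_(k <= l < N.+1) _ in err cmp.
have -> : part j (F z) - gv = (part j (F z) - ex) + (ex - tot) + (tot - gv).
  by rewrite !addrA !subrK.
apply: le_trans (ler_normD _ _) _; apply: lerD => //.
by apply: le_trans (ler_normD _ _) _; apply: lerD => //; exact: le_trans n2.
Qed.

End Continuation.

(** * Openness and relative closedness of the set of good points *)

Section GoodPoints.
Variables (R : realType) (C : function_class) (hC : good_class C).
Arguments C : clear implicits.
Local Notation K := (R[i]).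

Lemma good_point_nbhs (F : K -> K) (p : K) : good_point C F p ->
  exists2 dl : R, 0 < dl & forall q, cnorm (q - p) < dl -> good_point C F q.
Proof.
move=> [rho rho0 gp]; exists (rho / 2); first by rewrite divr_gt0.
move=> q /box_in_cnorm[q1 q2]; exists (rho / 2); first by rewrite divr_gt0.
apply: grid_approx_sub gp => z [z1 z2].
move: q1 q2 z1 z2; rewrite !ler_norml => q1 q2 z1 z2.
by split; rewrite ler_norml; lra.
Qed.

Lemma exists_nat_ge (x : R) : exists2 n, (0 < n)%N & x <= n%:R.
Proof.
exists (Num.Def.archi_bound `|x|).+1 => //; apply: le_trans (ler_norm x) _.
by apply/ltW; apply: lt_trans (archi_boundP (normr_ge0 x)) _; rewrite ltr_nat.
Qed.

Lemma good_point_closure (D : set R[i]^o) (F : R[i]^o -> R[i]^o) (p : R[i]^o) :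
  open D -> holomorphic_on D F -> D p ->
  (forall dl : R, 0 < dl -> exists2 q, cnorm (q - p) < dl & good_point C F q) ->
  good_point C F p.
Proof.
move=> oD hF Dp clp.
have /nbhs_cnormP[d1 d10 H1] : nbhs p D by exact: open_nbhs_nbhs.
have cF : ccont F p by exact/cdiff_ccont/derivable_cdiff/hF.
have [d2 d20 H2] := ccont_near cF; set M := cnorm (F p) + 1 in H2.
(* A square of half-side [r] has radius [2 r] in the sum norm, hence lies within half of each of the
   two given radii. *)
pose r := Num.min d1 d2 / 4.
have [r0 [r1 r2]] : 0 < r /\ r <= d1 / 4 /\ r <= d2 / 4.
  split; first by rewrite divr_gt0 // lt_min d10.
  by split; rewrite ler_pM2r ?invr_gt0 // ge_min lexx ?orbT.
pose x := complex.Re p; pose y := complex.Im p.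
have sq z : in_rect (x - r) (x + r) (y - r) (y + r) z -> cnorm (z - p) <= 2 * r.
  move=> /andP[zx zy]; rewrite mulr_natl mulr2n.
  by apply: lerD; rewrite ?ReD ?ImD ?ReN ?ImN -/x -/y ler_norml; lra.
have F_diff z : in_rect (x - r) (x + r) (y - r) (y + r) z -> cdiff F z.
  move=> /sq zp; apply: derivable_cdiff; apply: hF; apply: H1.
  by apply: le_lt_trans zp _; lra.
have F_bound z : in_rect (x - r) (x + r) (y - r) (y + r) z -> cnorm (F z) <= M.
  by move=> /sq zp; apply: H2; apply: le_lt_trans zp _; lra.
have r64 : 0 < r / 64 by rewrite divr_gt0.
have [q qp [rho0 rho00 gq]] := clp _ r64.
(* [v] approximates [q - p] within [1 / S] in each coordinate: [r / 128] keeps [|v|] below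
   [r / 64 + 2 (r / 128) <= r / 16], and [rho0 / 4] is a share of the box around [q]. *)
have [S S0 HS] := exists_nat_ge (Num.max (4 / rho0) (128 / r)).
have SR : 0 < S%:R :> R by rewrite ltr0n.
have [S1 S2] : S%:R^-1 <= rho0 / 4 /\ S%:R^-1 <= r / 128.
  have inv (s k : R) : 0 < s -> 0 < k -> k / s <= S%:R -> S%:R^-1 <= s / k.
    move=> s0 k0 h; rewrite -[s / k]invrK lef_pV2 ?posrE ?invr_gt0 ?divr_gt0 //.
    by rewrite invf_div.
  by move: HS; rewrite ge_max => /andP[h1 h2]; split; exact: inv.
have [v0 [v1 hv]] := exists_grid (complex.Re (q - p)) S0.
have [w0 [w1 hw]] := exists_grid (complex.Im (q - p)) S0.
(* The drift [(t - 1) v] of the nodes is at most [|v| / a <= rho0 / 4]. With the rounding of [v] and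
   [rho <= rho0 / 4], each also at most a quarter, [z + t v] stays in the box of radius [rho0] about
   [q]. *)
have [a a0 Ha] := exists_nat_ge (4 * r / rho0).
have aR : 0 < a%:R :> R by rewrite ltr0n.
have ra : a%:R^-1 * (r / 16) <= rho0 / 4.
  rewrite mulrC ler_pdivrMr //; move: Ha; rewrite ler_pdivrMr //; lra.
pose rho := Num.min (rho0 / 4) (r / 8).
have [rho_gt0 [rho1 rho2]] : 0 < rho /\ rho <= rho0 / 4 /\ rho <= r / 8.
  rewrite /rho; split; first by rewrite lt_min; apply/andP; split; exact: divr_gt0.
  by split; rewrite ge_min lexx ?orbT.
have vE0 : cnorm (grid_point R v0 v1 w0 w1 S) <= r / 16.
  rewrite /cnorm /=.
  have : cnorm (q - p) < r / 64 by [].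
  rewrite /cnorm.
  have := ler_normB (complex.Re (q - p)) (complex.Re (q - p) - grid_value R v0 v1 S).
  have := ler_normB (complex.Im (q - p)) (complex.Im (q - p) - grid_value R w0 w1 S).
  rewrite !opprB !addrA !(addrC _ (grid_value _ _ _ _)) !addrK; lra.
exists rho => //.
have pE : p = (x +i* y)%C :> K by rewrite /x /y; case: (p).
rewrite pE; apply: (grid_approx_extrapolation hC r0 F_diff F_bound S0 a0 vE0 rho2 _ gq).
move=> z t; rewrite -pE => -[z1 z2] /andP[t1 t2].
have tv (s : R) : `|s| <= r / 16 -> `|(t - 1) * s| <= rho0 / 4.
  move=> sr; apply: le_trans ra; rewrite normrM ger0_norm; last by lra.
  by apply: ler_pM => //; lra.
have tx := tv _ (le_trans (Re_le_cnorm _) vE0).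
have ty := tv _ (le_trans (Im_le_cnorm _) vE0).
move: hv hw tx ty z1 z2; rewrite /= ReD ImD ReN ImN !ler_norml => hv hw tx ty z1 z2.
set vx := grid_value R v0 v1 S in hv tx *; set vy := grid_value R w0 w1 S in hw ty *.
split; rewrite ?ReD ?ImD ?ReM ?ImM /= mul0r ?subr0 ?addr0 ler_norml -/vx -/vy.
  have -> : t * vx = vx + (t - 1) * vx by ring.
  by move: ((t - 1) * vx) tx => u tx; lra.
have -> : t * vy = vy + (t - 1) * vy by ring.
by move: ((t - 1) * vy) ty => u ty; lra.
Qed.

End GoodPoints.

Theorem theorem10p9 (R : realType) (C : function_class) (hC : good_class C)
    (D : set R[i]^o) (F : R[i]^o -> R[i]^o)
    (D_open : open D) (D_connected : connected D) (F_hol : holomorphic_on D F)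
    (F_in : exists U : set R[i]^o,
       [/\ open U, U !=set0, U `<=` D &
           in_class_on_open C (plane_set U) (plane_fun F)]) :
  forall K : set R[i]^o, compact K -> K `<=` D ->
    in_class_on_compact C (plane_set K) (plane_fun F).
Proof.
have [U [U_open [u Uu] UD FU]] := F_in.
pose good : set R[i]^o := [set p : R[i]^o | good_point C F p].
have good_open : open good.
  rewrite openE => p /good_point_nbhs[dl dl0 H]; apply/nbhs_cnormP.
  by exists dl.
have good_u : good u.
  have /nbhs_cnormP[dl dl0 H] : nbhs u U by exact: open_nbhs_nbhs.
  (* The box of twice this radius has sum-norm radius [dl / 2], so it is contained in [U]. *)
  exists (dl / 8); first by rewrite divr_gt0.
  apply: (grid_approx_of_open hC _ _ FU); first by rewrite divr_gt0.
  move=> z [z1 z2]; apply: H.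
  by rewrite /cnorm ReD ImD ReN ImN; lra.
have DE : D `&` good = D.
  apply: D_connected; first by exists u; split=> //; exact: UD.
    by exists good.
  (* Relative closedness: the limit points of [good] that lie in [D] are good by
     [good_point_closure]. *)
  exists (closure good); first exact: closed_closure.
  apply/seteqP; split=> [p [Dp gp]|p [Dp cp]]; first by split=> //; exact: subset_closure.
  split=> //; apply: (good_point_closure hC D_open F_hol Dp) => dl dl0.
  have /cp[q [gq /= qp]] : nbhs p [set q : R[i]^o | cnorm (q - p) < dl].
    by apply/nbhs_cnormP; exists dl.
  by exists q.
move=> K cK KD; apply: (compact_of_grid_approx hC); apply: (grid_approx_compact hC cK).
by move=> p /KD; rewrite -DE => -[].
Qed.
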